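(* Let $\mathcal{N}$ be a permutation model determined by a model $M$ of $\mathbf{ZFA}+\mathbf{AC}$, a group $G$ of permutations of the set $A$ of atoms, and a normal filter $\mathscr{F}$ on $G$ which is generated by some filter base $\mathscr{B}$ (of subgroups of $G$). If $\mathcal{N}$ satisfies the following two conditions: (a) for all $x\in\mathcal{N}$, $B\in\mathscr{B}$ and $\phi\in G$: if $B$ fixes $x$, then $B$ fixes $\phi(x)$; (b) for all $x\in\mathcal{N}$, the $G$-orbit $\mathrm{Orb}(x)=\{\phi(x):\phi\in G\}$ of $x$ is countable in $\mathcal{N}$, then $$\mathcal{N}\models(\forall X)(\mathbf{CAC}(X)\rightarrow\mathbf{CAC}(X^{\omega}))\wedge\mathbf{PS}_0(\mathbf{II}).$$
   Context: $\mathbf{ZFA}$ is Zermelo–Fraenkel set theory with atoms. Every permutation of the set $A$ of atoms of $M$ extends uniquely (by $\in$-recursion) to an $\in$-automorphism of $M$, with which it is identified. For a subgroup $H$ of $G$ and $x\in M$, ''$H$ fixes $x$'' means $\phi(x)=x$ for all $\phi\in H$. $\mathrm{sym}_G(x)=\{\phi\in G:\phi(x)=x\}$. A normal filter on $G$ is a non-empty family of subgroups of $G$ closed under supergroups, finite intersections and conjugation by elements of $G$, and containing $\mathrm{sym}_G(a)$ for each $a\in A$. The permutation (Fraenkel–Mostowski) model $\mathcal{N}$ determined by $M,G,\mathscr{F}$ is the class of all $x\in M$ that are hereditarily symmetric, i.e. $\mathrm{sym}_G(y)\in\mathscr{F}$ for $y=x$ and every $y$ in the transitive closure of $x$. A set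 is denumerable if equipotent to $\omega$, countable if it injects into $\omega$, uncountable otherwise. For a set $Y$, $\mathbf{CAC}(Y)$: every countable family of non-empty subsets of $Y$ has a choice function. $X^{\omega}$ is the set of functions $\omega\to X$. $\mathbf{PS}_0(\mathbf{II})$: if $X$ is any uncountable set and $\{A_n:n\in\omega\}$ is a denumerable family such that for every $n\in\omega$, $\emptyset\neq A_n\subseteq[X]^{<\omega}\setminus\{\emptyset\}$, and for every $n\in\omega$, the set $C_n=\{x\in[X]^{\leq\omega}:(\forall z\in A_n)\ x\cap z\neq\emptyset\}$ is non-empty, then the family $\{C_n:n\in\omega\}$ has a choice function. Here $[X]^{<\omega}$, $[X]^{\leq\omega}$ are the sets of finite, respectively countable, subsets of $X$. *)

(* Defs.v *)
Set Implicit Arguments.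
Unset Strict Implicit.
Unset Printing Implicit Defensive.

(** Structures for the first-order language of set theory with atoms.  All
    set-theoretic notions below are relations over an arbitrary structure, so
    that "[S] satisfies ..." is obtained by instantiating the structure: the
    quantifiers then range over the elements of [S] only. *)
Record structure : Type := Structure {
  carrier :> Type;
  mem : carrier -> carrier -> Prop;
  atom : carrier -> Prop }.

Arguments mem {s} _ _.
Arguments atom {s} _.

Declare Scope zfa_scope.
Open Scope zfa_scope.
Notation "x ∈ y" := (mem x y) (at level 70, no associativity) : zfa_scope.

Definition subset {S : structure} (x y : S) : Prop := forall z, z ∈ x -> z ∈ y.
Notation "x ⊆ y" := (subset x y) (at level 70, no associativity) : zfa_scope.

Definition substructure (S : structure) (P : S -> Prop) : structure :=
  @Structure {x : S | P x}
    (fun x y => proj1_sig x ∈ proj1_sig y) (fun x => atom (proj1_sig x)).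

(** Formulas (with de Bruijn indices) for Separation and Replacement, which are
    first-order schemata with parameters. *)
Inductive formula : Type :=
| FMem (i j : nat)
| FEq (i j : nat)
| FAtom (i : nat)
| FNot (p : formula)
| FAnd (p q : formula)
| FOr (p q : formula)
| FImp (p q : formula)
| FAll (p : formula)
| FEx (p : formula).

Definition scons (T : Type) (x : T) (e : nat -> T) (n : nat) : T :=
  match n with O => x | Datatypes.S m => e m end.

Fixpoint sat (S : structure) (e : nat -> S) (p : formula) : Prop :=
  match p with
  | FMem i j => e i ∈ e j
  | FEq i j => e i = e j
  | FAtom i => atom (e i)
  | FNot p => ~ sat e p
  | FAnd p q => sat e p /\ sat e q
  | FOr p q => sat e p \/ sat e q
  | FImp p q => sat e p -> sat e q
  | FAll p => forall x, sat (scons x e) p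
  | FEx p => exists x, sat (scons x e) p
  end.

Section Notions.
Context {S : structure}.
Implicit Types x y z f g h w p u v i c : S.

Definition isset x : Prop := ~ atom x.
Definition is_empty x : Prop := isset x /\ forall z, ~ z ∈ x.
Definition nonempty x : Prop := exists z, z ∈ x.
Definition transitive x : Prop := forall y z, y ∈ x -> z ∈ y -> z ∈ x.
Definition in_tc y x : Prop :=
  forall T, isset T -> transitive T -> x ⊆ T -> y ∈ T.

Definition is_pair p x y : Prop :=
  isset p /\ forall z, z ∈ p <-> z = x \/ z = y.
Definition is_opair p x y : Prop :=
  exists u v, is_pair u x x /\ is_pair v x y /\ is_pair p u v.
Definition is_succ y x : Prop :=
  isset y /\ forall z, z ∈ y <-> z ∈ x \/ z = x.
Definition inductive_set x : Prop :=
  isset x /\ (exists o, is_empty o /\ o ∈ x) /\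
  (forall y, y ∈ x -> exists z, is_succ z y /\ z ∈ x).
Definition is_omega w : Prop :=
  isset w /\ forall n, n ∈ w <-> forall x, inductive_set x -> n ∈ x.

Definition app f x y : Prop := exists p, is_opair p x y /\ p ∈ f.
Definition function_on f x : Prop :=
  isset f /\
  (forall p, p ∈ f -> exists u v, u ∈ x /\ is_opair p u v) /\
  (forall u, u ∈ x -> exists! v, app f u v).
Definition function f x y : Prop :=
  function_on f x /\ forall u v, app f u v -> v ∈ y.
Definition injection f x y : Prop :=
  function f x y /\ forall u u' v, app f u v -> app f u' v -> u = u'.
Definition bijection f x y : Prop :=
  injection f x y /\ forall v, v ∈ y -> exists u, app f u v.
Definition function_space p x y : Prop :=
  isset p /\ forall f, f ∈ p <-> function f x y.

Definition finite x : Prop :=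
  isset x /\ exists w n f, is_omega w /\ n ∈ w /\ bijection f x n.
Definition countable x : Prop :=
  isset x /\ exists w f, is_omega w /\ injection f x w.
Definition denumerable x : Prop :=
  isset x /\ exists w f, is_omega w /\ bijection f x w.

Definition has_choice_function x : Prop :=
  exists f, function_on f x /\ forall u v, app f u v -> v ∈ u.

Definition is_atom_set A : Prop := isset A /\ forall a : S, a ∈ A <-> atom a.

Definition is_perm (A f : S) : Prop := bijection f A A.
Definition is_identity (A f : S) : Prop :=
  function_on f A /\ forall a, a ∈ A -> app f a a.
(* h = g o f *)
Definition is_comp (A h g f : S) : Prop :=
  function_on h A /\ forall a b c, app f a b -> app g b c -> app h a c.
Definition is_inverse (A g f : S) : Prop :=
  function_on g A /\ forall a b, app f a b -> app g b a.

Definition perm_group (A G : S) : Prop :=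
  isset G /\
  (forall f, f ∈ G -> is_perm A f) /\
  (exists i, i ∈ G /\ is_identity A i) /\
  (forall f g, f ∈ G -> g ∈ G -> exists h, h ∈ G /\ is_comp A h g f) /\
  (forall f, f ∈ G -> exists g, g ∈ G /\ is_inverse A g f).
Definition subgroup (A G H : S) : Prop := perm_group A H /\ H ⊆ G.

Definition is_inter (I H K : S) : Prop :=
  isset I /\ forall z, z ∈ I <-> z ∈ H /\ z ∈ K.
(* C = phi H phi^-1 *)
Definition is_conjugate (A C phi H : S) : Prop :=
  isset C /\
  forall k, k ∈ C <->
    exists h i c, h ∈ H /\ is_inverse A i phi /\
      is_comp A c phi h /\ is_comp A k c i.

(** [acts phi x y] says that the extension of the permutation [phi] of the
    atoms maps [x] to [y].  It is the usual definition by recursion on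
    membership inside [S]: some [f] in [S], defined on a transitive set
    containing [x], satisfies the recursion equations and maps [x] to [y]. *)
Definition acts (phi x y : S) : Prop :=
  exists T f,
    isset T /\ transitive T /\ x ∈ T /\ function_on f T /\
    (forall u v, app f u v -> atom u -> app phi u v) /\
    (forall u v, app f u v -> isset u ->
       isset v /\ forall v', v' ∈ v <-> exists u', u' ∈ u /\ app f u' v') /\
    app f x y.

Definition fixes (H x : S) : Prop := forall phi, phi ∈ H -> acts phi x x.
Definition is_sym (G x K : S) : Prop :=
  isset K /\ forall phi, phi ∈ K <-> phi ∈ G /\ acts phi x x.
Definition is_orbit (G x O : S) : Prop :=
  isset O /\ forall y, y ∈ O <-> exists phi, phi ∈ G /\ acts phi x y.

Definition symmetric (G F x : S) : Prop := exists K, is_sym G x K /\ K ∈ F.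
Definition hereditarily_symmetric (G F x : S) : Prop :=
  symmetric G F x /\ forall y, in_tc y x -> symmetric G F y.

Definition normal_filter (A G F : S) : Prop :=
  isset F /\ nonempty F /\
  (forall H, H ∈ F -> subgroup A G H) /\
  (forall H K, H ∈ F -> subgroup A G K -> H ⊆ K -> K ∈ F) /\
  (forall H K, H ∈ F -> K ∈ F -> exists I, is_inter I H K /\ I ∈ F) /\
  (forall phi H, phi ∈ G -> H ∈ F ->
     exists C, is_conjugate A C phi H /\ C ∈ F) /\
  (forall a, a ∈ A -> symmetric G F a).

Definition filter_base (A G B : S) : Prop :=
  isset B /\ nonempty B /\
  (forall H, H ∈ B -> subgroup A G H) /\
  (forall H K, H ∈ B -> K ∈ B -> exists L, L ∈ B /\ L ⊆ H /\ L ⊆ K).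
Definition generated_by (A G B F : S) : Prop :=
  forall H, H ∈ F <-> subgroup A G H /\ exists K, K ∈ B /\ K ⊆ H.

Definition CAC (Y : S) : Prop :=
  forall K : S, countable K ->
    (forall k, k ∈ K -> isset k /\ nonempty k /\ k ⊆ Y) ->
    has_choice_function K.

(** [x] belongs to { x in [X]^{<= omega} : x meets every z in An }. *)
Definition in_C (X An x : S) : Prop :=
  countable x /\ x ⊆ X /\
  forall z, z ∈ An -> exists t, t ∈ x /\ t ∈ z.

End Notions.

Definition models_ZFA (S : structure) : Prop :=
  (forall a x : S, atom a -> ~ x ∈ a) /\
  (exists A : S, is_atom_set A) /\
  (forall x y : S, isset x -> isset y ->
     (forall z, z ∈ x <-> z ∈ y) -> x = y) /\
  (exists x : S, is_empty x) /\
  (forall x y : S, exists p, is_pair p x y) /\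
  (forall x : S, exists u, isset u /\
     forall z, z ∈ u <-> exists y, y ∈ x /\ z ∈ y) /\
  (forall x : S, exists p, isset p /\
     forall z, z ∈ p <-> isset z /\ z ⊆ x) /\
  (exists x : S, inductive_set x) /\
  (forall x : S, nonempty x ->
     exists y, y ∈ x /\ forall z, z ∈ x -> ~ z ∈ y) /\
  (forall (phi : formula) (e : nat -> S) (x : S), exists y, isset y /\
     forall z, z ∈ y <-> z ∈ x /\ sat (scons z e) phi) /\
  (forall (phi : formula) (e : nat -> S) (x : S),
     (forall u, u ∈ x -> exists! v, sat (scons u (scons v e)) phi) ->
     exists y, isset y /\
       forall v, v ∈ y <-> exists u, u ∈ x /\ sat (scons u (scons v e)) phi).

Definition models_AC (S : structure) : Prop :=
  forall x : S, isset x ->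
    (forall k, k ∈ x -> isset k /\ nonempty k) -> has_choice_function x.

Definition perm_model (M : structure) (G F : M) : structure :=
  substructure (hereditarily_symmetric G F).

Definition CAC_omega_power (S : structure) : Prop :=
  forall X : S, isset X -> CAC X ->
    exists w P : S, is_omega w /\ function_space P w X /\ CAC P.

(** The sequence (A_n) is a function [a] on omega with denumerable range [R];
    [K] is the set of all the C_n. *)
Definition PS0_II (S : structure) : Prop :=
  exists w : S, is_omega w /\
  forall X a : S,
    isset X -> ~ countable X ->
    function_on a w ->
    (exists R, isset R /\ denumerable R /\
       forall An, An ∈ R <-> exists n, n ∈ w /\ app a n An) ->
    (forall n An, n ∈ w -> app a n An ->
       isset An /\ nonempty An /\
       forall z, z ∈ An -> finite z /\ nonempty z /\ z ⊆ X) ->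
    (forall n An, n ∈ w -> app a n An -> exists x, in_C X An x) ->
    exists K, isset K /\
      (forall C, C ∈ K <->
         isset C /\ exists n An, n ∈ w /\ app a n An /\
           forall x, x ∈ C <-> in_C X An x) /\
      has_choice_function K.

(* Main.v *)
(** Write [S_b] for the class of sets fixed by a member [b] of the base.  By (a),
    [S_b] is closed under the action of [G], so an element is fixed by [b] as
    soon as one member of its orbit is.

    CAC of [X^omega]: choose, in [M], [f_k] in each member [k] of the countable
    family.  The sets [X ∩ Orb(f_k i)] are all fixed by a support of [X], so they
    form a countable family of the permutation model; by CAC of [X] it has a
    choice function there, supported by some [b].  Its values, hence by (a) all
    the [f_k i], are fixed by [b], so [k |-> f_k] is in the permutation model.

    PS_0(II): choose, in [M], [x_C] in each [C = C_n] and replace it by [y_C], the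
    set of all points of [X] in the orbit of a point of [x_C].  Then [C |-> y_C] is
    supported by any support of [X] and of the sequence.  If [e : x_C -> omega] is
    an injection supported by [b], then [b] fixes every point of [y_C] by (a), and
    [y_C] is covered by the domains of the countably many conjugates of [e] (b);
    thus [y_C] is countable in the permutation model.

    [M] may be ill-founded, so that all recursions and inductions take place
    inside [M], on first-order definable classes. *)

From Stdlib Require Import Classical PeanoNat.
Require Import Defs.

Set Implicit Arguments.
Unset Strict Implicit.

(** * Renaming the variables of formulas *)

Fixpoint rename (r : nat -> nat) (p : formula) : formula :=
  match p with
  | FMem i j => FMem (r i) (r j)
  | FEq i j => FEq (r i) (r j)
  | FAtom i => FAtom (r i)
  | FNot p => FNot (rename r p)
  | FAnd p q => FAnd (rename r p) (rename r q)
  | FOr p q => FOr (rename r p) (rename r q)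
  | FImp p q => FImp (rename r p) (rename r q)
  | FAll p => FAll (rename (scons 0 (fun m => S (r m))) p)
  | FEx p => FEx (rename (scons 0 (fun m => S (r m))) p)
  end.

(** * Definable classes *)

Section Definability.
Context {M : structure}.

Lemma sat_ext (p : formula) : forall e e' : nat -> M,
  (forall i, e i = e' i) -> (sat e p <-> sat e' p).
Proof.
  induction p; intros e e' H; cbn; rewrite ?H; try tauto;
    try (rewrite (IHp _ _ H); tauto);
    try (rewrite (IHp1 _ _ H), (IHp2 _ _ H); tauto).
  - split; intros h x; apply (IHp (scons x e) (scons x e')); auto;
      intros [|i]; cbn; auto.
  - split; intros [x h]; exists x; apply (IHp (scons x e) (scons x e')); auto;
      intros [|i]; cbn; auto.
Qed.

Lemma sat_rename (p : formula) : forall (r : nat -> nat) (e : nat -> M),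
  sat e (rename r p) <-> sat (fun i => e (r i)) p.
Proof.
  induction p; intros r e; cbn; try tauto;
    try (rewrite IHp; tauto); try (rewrite IHp1, IHp2; tauto).
  - split; intros h x; specialize (h x); rewrite IHp in *;
      (eapply sat_ext; [|exact h]); intros [|i]; reflexivity.
  - split; intros [x h]; exists x; rewrite IHp in *;
      (eapply sat_ext; [|exact h]); intros [|i]; reflexivity.
Qed.

Definition eval (e : nat -> M) (s : nat + M) : M :=
  match s with inl i => e i | inr c => c end.

(** [f] sends each free variable of the formula to a variable of the
    environment or to a parameter. *)
Definition definable (P : (nat -> M) -> Prop) : Prop :=
  exists p (f : nat -> nat + M), forall e, sat (fun k => eval e (f k)) p <-> P e.

Definition is_term (t : (nat -> M) -> M) : Prop :=
  exists s, forall e, eval e s = t e.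

Lemma term_var i : is_term (fun e => e i).
Proof. exists (inl i); reflexivity. Qed.

Lemma term_const c : is_term (fun _ => c).
Proof. exists (inr c); reflexivity. Qed.

Lemma definable_iff (P Q : (nat -> M) -> Prop) :
  (forall e, P e <-> Q e) -> definable P -> definable Q.
Proof.
  intros H (p & f & h); exists p, f; intros e; rewrite h; apply H.
Qed.

Lemma definable_mem t u : is_term t -> is_term u -> definable (fun e => t e ∈ u e).
Proof.
  intros [s hs] [s' hs']; exists (FMem 0 1), (scons s (fun _ => s')).
  intros e; cbn; rewrite hs, hs'; tauto.
Qed.

Lemma definable_eq t u : is_term t -> is_term u -> definable (fun e => t e = u e).
Proof.
  intros [s hs] [s' hs']; exists (FEq 0 1), (scons s (fun _ => s')).
  intros e; cbn; rewrite hs, hs'; tauto.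
Qed.

Lemma definable_atom t : is_term t -> definable (fun e => atom (t e)).
Proof.
  intros [s hs]; exists (FAtom 0), (fun _ => s); intros e; cbn; rewrite hs; tauto.
Qed.

Lemma definable_not P : definable P -> definable (fun e => ~ P e).
Proof.
  intros (p & f & H); exists (FNot p), f; intros e; cbn; rewrite H; tauto.
Qed.

(** A connective joins two formulas only under a common assignment of their variables. Moving the
    variables of one to the even indices and those of the other to the odd ones keeps the two
    assignments apart. *)
Lemma definable_merge P Q : definable P -> definable Q -> exists p q f,
  (forall e, sat (fun k => eval e (f k)) p <-> P e) /\
  (forall e, sat (fun k => eval e (f k)) q <-> Q e).
Proof.
  intros (p & f & H) (q & g & H').
  exists (rename (fun i => 2 * i) p), (rename (fun i => S (2 * i)) q),
    (fun k => if Nat.even k then f (Nat.div2 k) else g (Nat.div2 k)).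
  split; intros e; rewrite sat_rename; [rewrite <- H | rewrite <- H'];
    apply sat_ext; intros i.
  - rewrite Nat.even_mul, Nat.div2_double; reflexivity.
  - rewrite Nat.even_succ, Nat.odd_mul, Nat.div2_succ_double; reflexivity.
Qed.

Lemma definable_and P Q : definable P -> definable Q -> definable (fun e => P e /\ Q e).
Proof.
  intros HP HQ; destruct (definable_merge HP HQ) as (p & q & f & H & H').
  exists (FAnd p q), f; intros e; cbn; rewrite H, H'; tauto.
Qed.

Lemma definable_or P Q : definable P -> definable Q -> definable (fun e => P e \/ Q e).
Proof.
  intros HP HQ; destruct (definable_merge HP HQ) as (p & q & f & H & H').
  exists (FOr p q), f; intros e; cbn; rewrite H, H'; tauto.
Qed.

Lemma definable_imp P Q : definable P -> definable Q -> definable (fun e => P e -> Q e).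
Proof.
  intros HP HQ; destruct (definable_merge HP HQ) as (p & q & f & H & H').
  exists (FImp p q), f; intros e; cbn; rewrite H, H'; tauto.
Qed.

(** A quantifier binds variable 0 only, whereas [f] may send many variables to [inl 0]. All of these
    are merged into variable 0, and every other variable is shifted up by one and keeps its
    value. *)
Lemma unbind p (f : nat -> nat + M) : exists p' f', forall e x,
  sat (fun k => eval (scons x e) (f k)) p <->
  sat (scons x (fun k => eval e (f' k))) p'.
Proof.
  exists (rename (fun k => match f k with inl 0 => 0 | _ => S k end) p),
    (fun k => match f k with inl (S i) => inl i | s => s end).
  intros e x; rewrite sat_rename; apply sat_ext; intros k.
  destruct (f k) as [[|i]|c] eqn:E; cbn; rewrite ?E; reflexivity.
Qed.

(** The body is a predicate of the environment and of the bound object, so that plain unification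
    finds [Q] and moves the bound object to position 0 of the environment. The tactics for
    definability rely on this form. *)
Lemma definable_all (Q : (nat -> M) -> M -> Prop) :
  definable (fun e => Q (fun n => e (S n)) (e 0)) ->
  definable (fun e => forall x, Q e x).
Proof.
  intros (p & f & H); destruct (unbind p f) as (p' & f' & H').
  exists (FAll p'), f'; intros e; cbn.
  split; intros h x; [apply (H (scons x e)), H' | apply H', (H (scons x e))]; apply h.
Qed.

Lemma definable_ex (Q : (nat -> M) -> M -> Prop) :
  definable (fun e => Q (fun n => e (S n)) (e 0)) ->
  definable (fun e => exists x, Q e x).
Proof.
  intros (p & f & H); destruct (unbind p f) as (p' & f' & H').
  exists (FEx p'), f'; intros e; cbn.
  split; intros [x h]; exists x; [apply (H (scons x e)), H' | apply H', (H (scons x e))]; apply h.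
Qed.

Definition definable1 (P : M -> Prop) := definable (fun e => P (e 0)).
Definition definable2 (R : M -> M -> Prop) := definable (fun e => R (e 0) (e 1)).
Definition definable3 (R : M -> M -> M -> Prop) :=
  definable (fun e => R (e 0) (e 1) (e 2)).

Lemma definable_subst P (s : nat -> nat + M) :
  definable P -> definable (fun e => P (fun i => eval e (s i))).
Proof.
  intros (p & f & H).
  exists p, (fun k => match f k with inl i => s i | inr c => inr c end).
  intros e; rewrite <- H; apply sat_ext; intros k; destruct (f k); reflexivity.
Qed.

Lemma definable1_app P t : definable1 P -> is_term t -> definable (fun e => P (t e)).
Proof.
  intros H [s hs]; eapply definable_iff; [|exact (definable_subst (fun _ => s) H)].
  intros e; cbn; rewrite hs; tauto.
Qed.

Lemma definable2_app R t u : definable2 R -> is_term t -> is_term u ->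
  definable (fun e => R (t e) (u e)).
Proof.
  intros H [s hs] [s' hs'].
  eapply definable_iff; [|exact (definable_subst (scons s (fun _ => s')) H)].
  intros e; cbn; rewrite hs, hs'; tauto.
Qed.

Lemma definable3_app R t u v : definable3 R -> is_term t -> is_term u -> is_term v ->
  definable (fun e => R (t e) (u e) (v e)).
Proof.
  intros H [s hs] [s' hs'] [s'' hs''].
  eapply definable_iff;
    [|exact (definable_subst (scons s (scons s' (fun _ => s''))) H)].
  intros e; cbn; rewrite hs, hs', hs''; tauto.
Qed.

End Definability.

(** The domain on which recursion along membership is carried out. Every object moved by some
    [acts phi] satisfies it, and so does every hereditarily symmetric one. *)
Definition in_transitive {M : structure} (x : M) : Prop :=
  exists T, isset T /\ transitive T /\ x ∈ T.

(** * Automated proofs of definability *)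

Ltac definability_step :=
  match goal with
  | H : definable1 ?P |- definable _ => apply (definable1_app H)
  | H : definable2 ?P |- definable _ => apply (definable2_app H)
  | H : definable3 ?P |- definable _ => apply (definable3_app H)
  | |- definable _ => first
     [ apply definable_and | apply definable_or | apply definable_not
     | apply definable_imp | apply definable_all | apply definable_ex
     | apply definable_mem | apply definable_eq | apply definable_atom ]
  | |- is_term _ => first [ apply term_var | apply term_const ]
  end.

Ltac unfold_notions :=
  unfold definable1, definable2, definable3, function_space, bijection, injection,
    function, function_on, app, is_omega, inductive_set, is_succ, is_opair, is_pair,
    in_transitive, in_tc, transitive, nonempty, is_empty, isset, subset, unique, iff.

(** The long definition of the action is unfolded once here; afterwards [acts] counts as an atomic
    predicate. *)
Lemma definable_acts {M : structure} (t u v : (nat -> M) -> M) :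
  is_term t -> is_term u -> is_term v -> definable (fun e => acts (t e) (u e) (v e)).
Proof.
  intros ht hu hv.
  assert (D : definable3 (@acts M)).
  { unfold acts; unfold_notions; repeat (cbv beta; definability_step). }
  exact (definable3_app D ht hu hv).
Qed.

Lemma definable_hereditarily_symmetric {M : structure} (G F : M) :
  definable1 (hereditarily_symmetric G F).
Proof.
  unfold hereditarily_symmetric, symmetric, is_sym; unfold_notions.
  repeat (cbv beta; first [apply definable_acts | definability_step]).
Qed.

Ltac definability :=
  unfold_notions;
  repeat (cbv beta; first
    [ apply definable_acts
    | apply (definable1_app (definable_hereditarily_symmetric _ _))
    | definability_step ]).

(** * Set theory inside a model of ZFA *)

Section SetTheory.
Context {M : structure} (hZFA : models_ZFA M).

Lemma atom_empty (a x : M) : atom a -> ~ x ∈ a.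
Proof. destruct hZFA as (h & _); apply h. Qed.

Lemma isset_mem (x y : M) : x ∈ y -> isset y.
Proof. intros h a; exact (atom_empty a h). Qed.

Lemma extensionality (x y : M) : isset x -> isset y ->
  (forall z, z ∈ x <-> z ∈ y) -> x = y.
Proof. destruct hZFA as (_ & _ & h & _); apply h. Qed.

Lemma empty_ex : exists x : M, is_empty x.
Proof. destruct hZFA as (_ & _ & _ & h & _); apply h. Qed.

Lemma pair_ex (x y : M) : exists p, is_pair p x y.
Proof. destruct hZFA as (_ & _ & _ & _ & h & _); apply h. Qed.

Lemma union_ex (x : M) : exists u, isset u /\
     forall z, z ∈ u <-> exists y, y ∈ x /\ z ∈ y.
Proof. destruct hZFA as (_ & _ & _ & _ & _ & h & _); apply h. Qed.

Lemma power_ex (x : M) : exists p, isset p /\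
     forall z, z ∈ p <-> isset z /\ z ⊆ x.
Proof. destruct hZFA as (_ & _ & _ & _ & _ & _ & h & _); apply h. Qed.

Lemma foundation (x : M) : nonempty x ->
  exists y, y ∈ x /\ forall z, z ∈ x -> ~ z ∈ y.
Proof. destruct hZFA as (_ & _ & _ & _ & _ & _ & _ & _ & h & _); apply h. Qed.

Lemma separation (P : M -> Prop) (D : definable1 P) (x : M) : exists y,
  isset y /\ forall z, z ∈ y <-> z ∈ x /\ P z.
Proof.
  destruct D as (p & f & H); destruct (unbind p f) as (p' & f' & H').
  destruct hZFA as (_ & _ & _ & _ & _ & _ & _ & _ & _ & h & _).
  (* The environment [fun _ => x] is an arbitrary default: [P] looks at position 0 only. *)
  destruct (h p' (fun k => eval (fun _ => x) (f' k)) x) as (y & hy & E).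
  exists y; split; [exact hy|]; intros z; rewrite E, <- H', H; reflexivity.
Qed.

(** The schema asks for a total functional relation, while [R] may be partial on [x]. It is
    therefore applied to the subset [d] of those [u] that have a value. *)
Lemma replacement (R : M -> M -> Prop) (D : definable2 R) (x : M) :
  (forall u v v', u ∈ x -> R u v -> R u v' -> v = v') ->
  exists y, isset y /\ forall v, v ∈ y <-> exists u, u ∈ x /\ R u v.
Proof.
  intros F.
  destruct (@separation (fun u => exists v, R u v) ltac:(definability) x) as (d & _ & Ed).
  destruct D as (p & f & H).
  (* The schema reads the argument at variable 0 and the value at variable 1; all remaining
     variables and parameters move up by two. *)
  set (q := rename (fun k => match f k with inl 0 => 0 | inl 1 => 1 | _ => S (S k) end) p).
  assert (Hq : forall u v, R u v <->
    sat (scons u (scons v (fun k => eval (fun _ => x) (f k)))) q).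
  { intros u v; rewrite <- (H (scons u (scons v (fun _ => x)))).
    unfold q; rewrite sat_rename; apply sat_ext; intros k.
    destruct (f k) as [[|[|i]]|c] eqn:E; cbn; rewrite ?E; reflexivity. }
  destruct hZFA as (_ & _ & _ & _ & _ & _ & _ & _ & _ & _ & h).
  destruct (h q (fun k => eval (fun _ => x) (f k)) d) as (y & hy & E).
  { intros u hu; apply Ed in hu; destruct hu as [hu [v hv]].
    exists v; split; [apply Hq, hv|]; intros v' hv'; apply Hq in hv'; eauto. }
  exists y; split; [exact hy|]; intros v; rewrite E; split; intros [u [hu hv]];
    exists u; rewrite Ed in *; rewrite Hq in *; intuition.
  exists v; apply Hq; auto.
Qed.

Lemma opair_ex (x y : M) : exists p, is_opair p x y.
Proof.
  destruct (pair_ex x x) as [u hu], (pair_ex x y) as [v hv], (pair_ex u v) as [p hp].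
  exists p, u, v; auto.
Qed.

Lemma pair_unique (p p' x y : M) : is_pair p x y -> is_pair p' x y -> p = p'.
Proof.
  intros [s h] [s' h']; apply extensionality; auto; intros z; rewrite h, h'; tauto.
Qed.

Lemma opair_unique (p p' x y : M) : is_opair p x y -> is_opair p' x y -> p = p'.
Proof.
  intros (u & v & hu & hv & hp) (u' & v' & hu' & hv' & hp').
  rewrite <- (pair_unique hu hu'), <- (pair_unique hv hv') in hp'.
  eapply pair_unique; eauto.
Qed.

Lemma pair_inj (p x y x' y' : M) : is_pair p x y -> is_pair p x' y' ->
  (x = x' /\ y = y') \/ (x = y' /\ y = x').
Proof.
  intros [_ h] [_ h'].
  assert (E : forall z, z = x \/ z = y <-> z = x' \/ z = y') by
    (intros z; rewrite <- h, <- h'; tauto).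
  pose proof (proj1 (E x) (or_introl eq_refl)).
  pose proof (proj1 (E y) (or_intror eq_refl)).
  pose proof (proj2 (E x') (or_introl eq_refl)).
  pose proof (proj2 (E y') (or_intror eq_refl)).
  intuition congruence.
Qed.

Lemma opair_inj (p x y x' y' : M) : is_opair p x y -> is_opair p x' y' ->
  x = x' /\ y = y'.
Proof.
  intros (u & v & hu & hv & hp) (u' & v' & hu' & hv' & hp').
  destruct (pair_inj hp hp') as [[-> ->]|[-> ->]].
  - destruct (pair_inj hu hu') as [[-> _]|[-> _]];
      destruct (pair_inj hv hv'); intuition congruence.
  - destruct (pair_inj hu hv');
      destruct (pair_inj hv hu'); intuition congruence.
Qed.

Lemma app_opair (f p x y : M) : is_opair p x y -> (app f x y <-> p ∈ f).
Proof.
  intros h; split; [intros (q & hq & hm)|exists p; auto].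
  rewrite (opair_unique h hq); exact hm.
Qed.

Lemma function_on_dom (f x u v : M) : function_on f x -> app f u v -> u ∈ x.
Proof.
  intros (_ & h & _) (p & hp & hm); destruct (h p hm) as (u' & v' & hu & hp').
  destruct (opair_inj hp hp'); congruence.
Qed.

Lemma function_on_unique (f x u v v' : M) :
  function_on f x -> app f u v -> app f u v' -> v = v'.
Proof.
  intros h a a'; pose proof (function_on_dom h a) as hu.
  destruct h as (_ & _ & h); destruct (h u hu) as (w & _ & hw).
  rewrite <- (hw v a); auto.
Qed.

Lemma function_on_total (f x u : M) : function_on f x -> u ∈ x -> exists v, app f u v.
Proof. intros (_ & _ & h) hu; destruct (h u hu) as (v & hv & _); eauto. Qed.

Lemma partial_graph_ex (R : M -> M -> Prop) (D : definable2 R) (x : M) :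
  (forall u v v', u ∈ x -> R u v -> R u v' -> v = v') ->
  exists f, isset f /\ (forall p, p ∈ f -> exists u v, u ∈ x /\ is_opair p u v) /\
    forall u v, app f u v <-> u ∈ x /\ R u v.
Proof.
  intros F.
  destruct (@replacement (fun u p => exists v, is_opair p u v /\ R u v)
     ltac:(definability) x) as (f & hf & E).
  { intros u p p' hu (v & hp & hv) (v' & hp' & hv').
    rewrite (F _ _ _ hu hv' hv) in hp'; eapply opair_unique; eauto. }
  exists f; split; [exact hf|split].
  - intros p hp; apply E in hp; destruct hp as (u & hu & v & hp & _); eauto.
  - intros u v; destruct (opair_ex u v) as [p hp]; rewrite (app_opair f hp), E.
    split; [intros (u' & hu & v' & hp' & hv)|intros [hu hv]; eauto].
    destruct (opair_inj hp hp'); subst; auto.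
Qed.

Lemma graph_ex (R : M -> M -> Prop) (D : definable2 R) (x : M) :
  (forall u, u ∈ x -> exists v, R u v) ->
  (forall u v v', u ∈ x -> R u v -> R u v' -> v = v') ->
  exists f, function_on f x /\ forall u v, app f u v <-> u ∈ x /\ R u v.
Proof.
  intros T F; destruct (partial_graph_ex D F) as (f & hf & hp & E).
  exists f; split; [|exact E]; split; [exact hf|split; [exact hp|]].
  intros u hu; destruct (T u hu) as [v hv]; exists v; split; [apply E; auto|].
  intros v' h; apply E in h; destruct h; eauto.
Qed.

(** The product is the union of the slices [{u} × y]; replacement yields both the set of slices and
    each single slice. *)
Lemma product_ex (x y : M) : exists z, isset z /\
  forall p, p ∈ z <-> exists u v, u ∈ x /\ v ∈ y /\ is_opair p u v.
Proof.
  destruct (@replacement (fun u s => isset s /\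
     forall p, p ∈ s <-> exists v, v ∈ y /\ is_opair p u v) ltac:(definability) x)
     as (k & hk & E).
  { intros u s s' _ [h h1] [h' h1']; apply extensionality; auto.
    intros z; rewrite h1, h1'; tauto. }
  destruct (union_ex k) as (z & hz & Ez).
  exists z; split; [exact hz|]; intros p; rewrite Ez; split.
  - intros (s & hs & hp); apply E in hs; destruct hs as (u & hu & _ & hs).
    apply hs in hp; destruct hp as (v & hv & hp); eauto.
  - intros (u & v & hu & hv & hp).
    destruct (@replacement (fun v p => is_opair p u v) ltac:(definability) y)
      as (s & hs & Es).
    { intros; eapply opair_unique; eauto. }
    exists s; split; [apply E; exists u; split; [auto|]; split; auto|].
    apply Es; eauto.
Qed.

Lemma relation_ex (R : M -> M -> Prop) (D : definable2 R) (x y : M) :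
  exists z, isset z /\ forall u v, app z u v <-> u ∈ x /\ v ∈ y /\ R u v.
Proof.
  destruct (product_ex x y) as (k & _ & Ek).
  destruct (@separation (fun p => exists u v, is_opair p u v /\ R u v)
     ltac:(definability) k) as (z & hz & Ez).
  exists z; split; [exact hz|]; intros u v; destruct (opair_ex u v) as [p hp].
  rewrite (app_opair z hp), Ez, Ek; split.
  - intros ((u' & v' & hu & hv & hp') & u1 & v1 & hp1 & h).
    destruct (opair_inj hp hp'), (opair_inj hp hp1); subst; auto.
  - intros (hu & hv & h); split; eauto 6.
Qed.

(** * Consequences of foundation and the natural numbers of the model *)

Lemma mem_irrefl (x : M) : ~ x ∈ x.
Proof.
  intros h; destruct (pair_ex x x) as [p [_ hp]].
  destruct (@foundation p) as (y & hy & hm); [exists x; apply hp; auto|].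
  apply (hm x); [apply hp; auto|]; apply hp in hy; destruct hy; subst; auto.
Qed.

Lemma mem_asym (x y : M) : x ∈ y -> ~ y ∈ x.
Proof.
  intros h h'; destruct (pair_ex x y) as [p [_ hp]].
  destruct (@foundation p) as (z & hz & hm); [exists x; apply hp; auto|].
  apply hp in hz; destruct hz; subst.
  - apply (hm y); auto; apply hp; auto.
  - apply (hm x); auto; apply hp; auto.
Qed.

(** Otherwise each of [x] and [y] would be a member of the other, against foundation. *)
Lemma succ_inj (s x y : M) : is_succ s x -> is_succ s y -> x = y.
Proof.
  intros [_ h] [_ h'].
  assert (hx : x ∈ s) by (apply h; auto); assert (hy : y ∈ s) by (apply h'; auto).
  apply h' in hx; apply h in hy; destruct hx as [hx|]; auto.
  destruct hy as [hy|]; auto; destruct (mem_asym hx hy).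
Qed.

Lemma succ_not_empty (s x : M) : is_succ s x -> ~ is_empty s.
Proof. intros [_ h] [_ h']; apply (h' x), h; auto. Qed.

Lemma succ_unique (s s' x : M) : is_succ s x -> is_succ s' x -> s = s'.
Proof.
  intros [h1 h] [h1' h']; apply extensionality; auto; intros z; rewrite h, h'; tauto.
Qed.

Lemma empty_unique (x y : M) : is_empty x -> is_empty y -> x = y.
Proof.
  intros [h1 h] [h1' h']; apply extensionality; auto; intros z.
  split; intros a; [destruct (h z a)|destruct (h' z a)].
Qed.

Lemma omega_ex : exists w : M, is_omega w.
Proof.
  destruct hZFA as (_ & _ & _ & _ & _ & _ & _ & [i hi] & _).
  destruct (@separation (fun n => forall x, inductive_set x -> n ∈ x)
     ltac:(definability) i) as (w & hw & E).
  exists w; split; [exact hw|]; intros n; rewrite E; split; [tauto|auto].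
Qed.

Lemma omega_inductive (w : M) : is_omega w -> inductive_set w.
Proof.
  intros [hw E]; split; [exact hw|split].
  - destruct empty_ex as [o ho]; exists o; split; [exact ho|].
    apply E; intros x (_ & (o' & ho' & h) & _); rewrite (empty_unique ho ho'); exact h.
  - intros n hn; rewrite E in hn; destruct (pair_ex n n) as [p hp].
    destruct (pair_ex n p) as [q hq], (union_ex q) as (s & hs & Es).
    assert (h : is_succ s n).
    { split; [exact hs|]; intros z; rewrite Es; destruct hp as [_ hp], hq as [_ hq].
      split.
      - intros (y & hy & hz); apply hq in hy; destruct hy as [->| ->]; auto.
        apply hp in hz; tauto.
      - intros [hz|hz]; [exists n|exists p]; rewrite hq; auto.
        split; auto; apply hp; auto. }
    exists s; split; [exact h|]; apply E; intros x hx.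
    destruct (hx) as (_ & _ & c); destruct (c n (hn x hx)) as (s' & hs' & hm).
    rewrite (succ_unique h hs'); exact hm.
Qed.

Section Omega.
Context (w : M) (hw : is_omega w).

Lemma empty_in_omega (o : M) : is_empty o -> o ∈ w.
Proof.
  intros ho; destruct (omega_inductive hw) as (_ & (o' & ho' & h) & _).
  rewrite (empty_unique ho ho'); exact h.
Qed.

Lemma succ_in_omega (n s : M) : n ∈ w -> is_succ s n -> s ∈ w.
Proof.
  intros hn hs; destruct (omega_inductive hw) as (_ & _ & h).
  destruct (h n hn) as (s' & hs' & hm); rewrite (succ_unique hs hs'); exact hm.
Qed.

Lemma succ_ex (n : M) : n ∈ w -> exists s, is_succ s n /\ s ∈ w.
Proof. intros hn; destruct (omega_inductive hw) as (_ & _ & h); auto. Qed.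

(** Separation turns the class [P] into a subset of [w], which is inductive and hence all of [w]. *)
Lemma omega_ind (P : M -> Prop) (D : definable1 P) :
  (forall o, is_empty o -> P o) ->
  (forall n s, n ∈ w -> P n -> is_succ s n -> P s) -> forall n, n ∈ w -> P n.
Proof.
  intros h0 hS n hn; destruct (separation D w) as (y & hy & E).
  destruct hw as [_ Ew]; apply (E n), (proj1 (Ew n) hn).
  split; [exact hy|split].
  - destruct empty_ex as [o ho]; exists o; split; [exact ho|].
    apply E; split; auto using empty_in_omega.
  - intros m hm; apply E in hm; destruct hm as [hm hP].
    destruct (succ_ex hm) as (s & hs & hsw); exists s; split; [exact hs|].
    apply E; eauto.
Qed.

(** [E] is the least relation containing [(0, y0)] and closed under
    [(n, p) |-> (n + 1, q)] for [N p q]. *)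
Lemma iteration_ex (N : M -> M -> Prop) (D : definable2 N) (Y y0 : M) : y0 ∈ Y ->
  (forall p q, p ∈ Y -> N p q -> q ∈ Y) ->
  (forall p q q', N p q -> N p q' -> q = q') ->
  exists E,
    (forall n p p', app E n p -> app E n p' -> p = p') /\
    (forall n p, app E n p -> n ∈ w) /\
    (exists n, app E n y0) /\
    (forall n p q, app E n p -> N p q -> exists n', app E n' q).
Proof.
  intros h0 hY F.
  pose (closed (Z : M) := (forall n, is_empty n -> app Z n y0) /\
    forall n n' p q, n ∈ w -> app Z n p -> is_succ n' n -> N p q -> app Z n' q).
  destruct (@relation_ex (fun n p => forall Z, closed Z -> app Z n p)
     ltac:(unfold closed; definability) w Y) as (E & _ & hE).
  assert (cE : closed E).
  { split.
    - intros n hn; apply hE; repeat split; auto using empty_in_omega.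
      intros Z [c _]; auto.
    - intros n n' p q hn hp hs hN; apply hE in hp; destruct hp as (_ & hp & h).
      apply hE; split; [eauto using succ_in_omega|split; [eauto|]].
      intros Z cZ; destruct (cZ) as [_ c]; eapply c; eauto. }
  (* Inversion by minimality: the pairs of [E] having one of the two shapes already form a closed
     relation [Z]. *)
  assert (inv : forall m r, app E m r -> (is_empty m /\ r = y0) \/
     exists n p, is_succ m n /\ app E n p /\ N p r).
  { destruct (@relation_ex (fun m r => app E m r /\ ((is_empty m /\ r = y0) \/
     exists n p, is_succ m n /\ app E n p /\ N p r)) ltac:(definability) w Y)
     as (Z & _ & hZ).
    intros m r hr; apply (hZ m r); apply hE in hr; apply hr; split.
    - intros n hn; apply hZ; repeat split; auto using empty_in_omega.
      apply cE; auto.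
    - intros n n' p q hn hp hs hN; apply hZ in hp; destruct hp as (_ & hp & h & _).
      apply hZ; split; [eauto using succ_in_omega|split; [eauto|split; [|right; eauto]]].
      destruct cE as [_ c]; eapply c; eauto. }
  exists E; repeat split.
  - enough (K : forall n, n ∈ w -> forall p p', app E n p -> app E n p' -> p = p').
    { intros n p p' h; apply K; auto; apply hE in h; tauto. }
    refine (@omega_ind (fun n => _) _ _ _); [definability| |].
    + intros o ho p p' h h'.
      destruct (inv _ _ h) as [[_ ->]|(n & _ & hn & _)];
        [|destruct (succ_not_empty hn ho)].
      destruct (inv _ _ h') as [[_ ->]|(n & _ & hn & _)];
        [auto|destruct (succ_not_empty hn ho)].
    + intros n s hn IH hs p p' h h'.
      destruct (inv _ _ h) as [[ho _]|(m & r & hm & hr & hN)];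
        [destruct (succ_not_empty hs ho)|].
      destruct (inv _ _ h') as [[ho _]|(m' & r' & hm' & hr' & hN')];
        [destruct (succ_not_empty hs ho)|].
      rewrite (succ_inj hm hs) in hr; rewrite (succ_inj hm' hs) in hr'.
      rewrite (IH r' r hr' hr) in hN'; eauto.
  - intros n p h; apply hE in h; tauto.
  - destruct empty_ex as [o ho]; exists o; apply cE, ho.
  - intros n p q h hN; pose proof (proj1 (hE _ _) h) as (hn & _).
    destruct (succ_ex hn) as (s & hs & _); exists s.
    destruct cE as [_ c]; eapply c; eauto.
Qed.

(** Cantor's enumeration of [w * w]: [(a + 1, b)] is followed by [(a, b + 1)],
    and [(0, b)] by [(b + 1, 0)]. *)
Lemma pairing_ex : exists E : M,
  (forall n p p', app E n p -> app E n p' -> p = p') /\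
  (forall n p, app E n p -> n ∈ w) /\
  (forall i j, i ∈ w -> j ∈ w -> exists n p, is_opair p i j /\ app E n p).
Proof.
  pose (N (p q : M) :=
    (exists a a' b b', is_succ a' a /\ is_succ b' b /\
       is_opair p a' b /\ is_opair q a b') \/
    (exists o b b', is_empty o /\ is_succ b' b /\ is_opair p o b /\ is_opair q b' o)).
  assert (D : definable2 N) by (unfold N; definability).
  destruct (product_ex w w) as (Y & _ & hY), empty_ex as [o ho].
  destruct (opair_ex o o) as [y0 hy0].
  pose proof (empty_in_omega ho) as how.
  assert (hN : forall p q, p ∈ Y -> N p q -> q ∈ Y).
  { intros p q hp; apply hY in hp; destruct hp as (u & v & hu & hv & hp).
    intros [(a & a' & b & b' & ha & hb & hp' & hq)|(z & b & b' & hz & hb & hp' & hq)];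
      destruct (opair_inj hp hp'); subst; apply hY.
    - exists a, b'; repeat split; eauto using succ_in_omega.
      (* The predecessor of a natural number is a natural number, by induction. *)
      clear - hu ha hw hZFA; revert a' hu a ha; enough (K : forall n, n ∈ w -> forall a, is_succ n a -> a ∈ w)
        by (intros; eapply K; eauto).
      refine (@omega_ind (fun n => _) _ _ _); [definability| |].
      + intros z hz a h; destruct (succ_not_empty h hz).
      + intros n s hn _ hs a h; rewrite (succ_inj h hs); exact hn.
    - exists b', z; repeat split; eauto using succ_in_omega. }
  destruct (@iteration_ex N D Y y0) as (E & F & Ew & Z0 & ZS);
    [apply hY; eauto|exact hN| |].
  { intros p q q' h h'.
    destruct h as [(a & a' & b & b' & ha & hb & hp & hq)|(z & b & b' & hz & hb & hp & hq)];
    destruct h' as [(c & c' & d & d' & hc & hd & hp' & hq')|(y & d & d' & hy & hd & hp' & hq')];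
    destruct (opair_inj hp hp'); subst.
    - rewrite (succ_inj ha hc), (succ_unique hb hd) in hq; eapply opair_unique; eauto.
    - destruct (succ_not_empty ha hy).
    - destruct (succ_not_empty hc hz).
    - rewrite (succ_unique hb hd) in hq; eapply opair_unique; eauto. }
  exists E; split; [exact F|split; [exact Ew|]].
  pose (R (i j : M) := exists n p, is_opair p i j /\ app E n p).
  assert (DR : definable2 R) by (unfold R; definability).
  (* [R i j] says that the enumeration reaches [(i, j)]. It holds at the start and is preserved by
     both kinds of step. *)
  assert (R0 : R o o) by (destruct Z0 as [n hn]; exists n, y0; auto).
  assert (RS : forall a a' b b', is_succ a' a -> is_succ b' b -> R a' b -> R a b').
  { intros a a' b b' ha hb (n & p & hp & h); destruct (opair_ex a b') as [q hq].
    destruct (ZS n p q h) as [n' h']; [left; exists a, a', b, b'; auto|].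
    exists n', q; auto. }
  assert (RT : forall b b', is_succ b' b -> R o b -> R b' o).
  { intros b b' hb (n & p & hp & h); destruct (opair_ex b' o) as [q hq].
    destruct (ZS n p q h) as [n' h']; [right; exists o, b, b'; auto|].
    exists n', q; auto. }
  (* Walking down an antidiagonal leads from [(n, 0)] to [(0, n)]. The induction quantifies over all
     [Z], since its step passes to the shifted relation [Z' a b := Z (a + 1) b]; [Z] has to be a set
     for this to be a definable class. *)
  assert (diag : forall n, n ∈ w -> forall Z : M, app Z n o ->
    (forall a a' b b', a ∈ w -> b ∈ w -> is_succ a' a -> is_succ b' b ->
       app Z a' b -> app Z a b') -> app Z o n).
  { refine (@omega_ind (fun n => _) _ _ _); [definability| |].
    - intros z hz Z h _; rewrite (empty_unique hz ho) in *; exact h.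
    - intros n s hn IH hs Z h c.
      destruct (@relation_ex (fun a b => exists a', is_succ a' a /\ app Z a' b)
        ltac:(definability) w w) as (Z' & _ & hZ').
      destruct (succ_ex how) as (e & he & _).
      assert (h' : app Z' o n).
      { apply IH.
        - apply hZ'; repeat split; eauto.
        - intros a a' b b' ha hb hsa hsb h'; apply hZ' in h'.
          destruct h' as (ha' & _ & a2 & ha2 & h').
          apply hZ'; repeat split; eauto using succ_in_omega. }
      apply hZ' in h'; destruct h' as (_ & _ & e' & he' & h').
      exact (c _ _ _ _ how hn he' hs h'). }
  destruct (@relation_ex R DR w w) as (Z & _ & hZ).
  (* From [(n, 0)] the antidiagonal leads to [(0, n)], whose successor is [(n + 1, 0)]. *)
  assert (row0 : forall i, i ∈ w -> R i o).
  { refine (@omega_ind (fun n => _) _ _ _); [definability| |].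
    - intros z hz; rewrite (empty_unique hz ho); exact R0.
    - intros n s hn IH hs; apply (RT n s hs); apply (hZ o n), diag; auto.
      + apply hZ; auto.
      + intros a a' b b' ha hb hsa hsb h; apply hZ in h; destruct h as (_ & _ & h).
        apply hZ; repeat split; eauto using succ_in_omega. }
  enough (K : forall j, j ∈ w -> forall i, i ∈ w -> R i j) by (intros i j hi hj; apply K; auto).
  refine (@omega_ind (fun n => _) _ _ _); [definability| |].
  - intros z hz i hi; rewrite (empty_unique hz ho); auto.
  - intros n s hn IH hs i hi; destruct (succ_ex hi) as (i' & hi' & hi'w).
    eapply RS; eauto.
Qed.

End Omega.

(** * Choice in [M] and injections into omega *)

Section Choice.
Context (hAC : models_AC M).

(** The axiom of choice is applied to the sets [{n ∈ Z : T v n}], and the choice made there is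
    pulled back along [v]. *)
Lemma choice_function (T : M -> M -> Prop) (D : definable2 T) (y Z : M) :
  (forall v, v ∈ y -> exists n, n ∈ Z /\ T v n) ->
  exists f, function f y Z /\ forall v n, app f v n -> T v n.
Proof.
  intros h.
  pose (Q (v q : M) := isset q /\ forall n, n ∈ q <-> n ∈ Z /\ T v n).
  assert (DQ : definable2 Q) by (unfold Q; definability).
  assert (FQ : forall v q q', Q v q -> Q v q' -> q = q').
  { intros v q q' [hq Eq] [hq' Eq']; apply extensionality; auto.
    intros z; rewrite Eq, Eq'; tauto. }
  destruct (@replacement Q DQ y) as (K & hK & EK); [eauto|].
  destruct (hAC hK) as (c & hc & Ec).
  { intros k hk; apply EK in hk; destruct hk as (v & hv & hq & Eq).
    split; [exact hq|]; destruct (h v hv) as [n hn]; exists n; apply Eq; exact hn. }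
  destruct (@graph_ex (fun v n => exists q, Q v q /\ app c q n) ltac:(definability) y)
    as (f & hf & Ef).
  - intros v hv.
    destruct (@separation (T v) ltac:(definability) Z) as (q & hq & Eq).
    destruct (@function_on_total c K q hc) as [n hn].
    { apply EK; exists v; split; [exact hv|]; split; auto. }
    exists n, q; split; [split; auto|exact hn].
  - intros v n n' _ (q & hq & hn) (q' & hq' & hn').
    rewrite (FQ _ _ _ hq' hq) in hn'; eapply function_on_unique; eauto.
  - assert (K' : forall v n, app f v n -> n ∈ Z /\ T v n).
    { intros v n hn; apply Ef in hn; destruct hn as (_ & q & hq & hn).
      apply hq, Ec, hn. }
    exists f; split; [split; [exact hf|]|]; intros v n hn; apply (K' v n hn).
Qed.

(** [R] names each element of [y] by pairs of natural numbers. The enumeration of pairs turns such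
    names into single numbers, and choosing one name for each element gives the injection. Both
    countability arguments for the theorem end in this lemma. *)
Lemma injection_omega_ex (w : M) (hw : is_omega w) (R : M -> M -> M -> Prop)
  (D : definable3 R) (y : M) :
  (forall v, v ∈ y -> exists i j, i ∈ w /\ j ∈ w /\ R i j v) ->
  (forall i j v v', v ∈ y -> v' ∈ y -> R i j v -> R i j v' -> v = v') ->
  exists f, injection f y w.
Proof.
  intros T F; destruct (pairing_ex hw) as (E & FE & wE & EE).
  destruct (@choice_function
    (fun v n => exists p i j, app E n p /\ is_opair p i j /\ R i j v)
    ltac:(definability) y w) as (f & hf & hT).
  { intros v hv; destruct (T v hv) as (i & j & hi & hj & h).
    destruct (EE i j hi hj) as (n & p & hp & hn).
    exists n; split; [eauto|]; exists p, i, j; auto. }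
  exists f; split; [exact hf|].
  intros v v' n h h'.
  destruct (hT _ _ h) as (p & i & j & hp & hij & hR).
  destruct (hT _ _ h') as (p' & i' & j' & hp' & hij' & hR').
  rewrite (FE _ _ _ hp' hp) in hij'; destruct (opair_inj hij hij'); subst i' j'.
  destruct hf as [hf _].
  apply (F i j); eauto using function_on_dom.
Qed.

End Choice.

(** * Transitive sets and induction on membership *)

Lemma transitive_hull_ex (x : M) : in_transitive x -> exists t,
  isset t /\ transitive t /\ x ∈ t /\
  forall T, isset T -> transitive T -> x ∈ T -> t ⊆ T.
Proof.
  intros (T & hT & tT & hx).
  destruct (@separation (fun z => forall T, isset T -> transitive T -> x ∈ T -> z ∈ T)
    ltac:(definability) T) as (t & ht & Et).
  exists t; split; [exact ht|split; [|split]].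
  - intros y z hy hz; apply Et in hy; destruct hy as [hy h]; apply Et; split; eauto.
  - apply Et; auto.
  - intros T' hT' tT' hx' z hz; apply Et in hz; apply hz; auto.
Qed.

Lemma in_transitive_mem (x y : M) : in_transitive x -> y ∈ x -> in_transitive y.
Proof. intros (T & hT & tT & hx) hy; exists T; eauto. Qed.

Lemma adjoin_ex (x a : M) : exists y, isset y /\ forall z, z ∈ y <-> z ∈ x \/ z = a.
Proof.
  destruct (pair_ex a a) as [s [_ hs]], (pair_ex x s) as [p [_ hp]], (union_ex p) as (y & hy & E).
  exists y; split; [exact hy|]; intros z; rewrite E; split.
  - intros (u & hu & hz); apply hp in hu; destruct hu as [->| ->]; auto.
    apply hs in hz; tauto.
  - intros [hz|hz]; [exists x|exists s]; rewrite hp, ?hs; auto.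
Qed.

(** The least transitive set around a member is unique, so replacement can collect these sets. Their
    union, with [x] adjoined, is transitive. *)
Lemma in_transitive_intro (x : M) : (forall u, u ∈ x -> in_transitive u) -> in_transitive x.
Proof.
  intros h.
  destruct (@replacement (fun u t => isset t /\ transitive t /\ u ∈ t /\
     forall T, isset T -> transitive T -> u ∈ T -> t ⊆ T) ltac:(definability) x)
     as (K & _ & EK).
  { intros u t t' _ (h1 & h2 & h3 & h4) (h1' & h2' & h3' & h4').
    apply extensionality; auto; intros z; split; [apply h4|apply h4']; auto. }
  destruct (union_ex K) as (U & _ & EU), (adjoin_ex U x) as (T & hT & ET).
  assert (hU : forall u, u ∈ x -> u ∈ U).
  { intros u hu; destruct (transitive_hull_ex (h u hu)) as (t & ht).
    apply EU; exists t; split; [apply EK; eauto|tauto]. }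
  exists T; split; [exact hT|split; [|apply ET; auto]].
  intros y z hy hz; apply ET; left; apply ET in hy; destruct hy as [hy| ->]; [|auto].
  apply EU in hy; destruct hy as (t & ht & hy); apply EU; exists t; split; [exact ht|].
  apply EK in ht; destruct ht as (u & _ & _ & tt & _); eauto.
Qed.

(** Foundation speaks of sets only. A transitive set [T] around a counterexample supplies the set of
    counterexamples in [T], and a minimal member of it contradicts the induction step. *)
Lemma in_transitive_ind (P : M -> Prop) (D : definable1 P) :
  (forall x, in_transitive x -> (forall u, u ∈ x -> P u) -> P x) ->
  forall x, in_transitive x -> P x.
Proof.
  intros h x (T & hT & tT & hx); apply NNPP; intros n.
  destruct (@separation (fun z => ~ P z) ltac:(definability) T) as (N & _ & EN).
  destruct (@foundation N) as (y & hy & hm); [exists x; apply EN; auto|].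
  apply EN in hy; destruct hy as [hy nP]; apply nP, h; [exists T; auto|].
  intros u hu; apply NNPP; intros nu; apply (hm u); [apply EN; eauto|exact hu].
Qed.

(** * The action of permutations of the atoms *)

Section Atoms.
Context (A : M) (hA : is_atom_set A).

(** * Recursion equations of the action, for a group [H] that is later [G] or a member of the
    base *)

Section Action.
Context (H : M) (hH : perm_group A H).

Lemma perm_function (phi : M) : phi ∈ H -> function_on phi A.
Proof. destruct hH as (_ & h & _); intros hp; apply (h phi hp). Qed.

Lemma perm_app (phi a : M) : phi ∈ H -> atom a -> exists b, app phi a b.
Proof.
  intros hp ha; apply (function_on_total (perm_function hp)), hA, ha.
Qed.

Lemma perm_app_atom (phi a b : M) : phi ∈ H -> app phi a b -> atom a /\ atom b.
Proof.
  intros hp h; split; apply hA.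
  - eapply function_on_dom; [apply perm_function|]; eauto.
  - destruct hH as (_ & h' & _); destruct (h' phi hp) as [[[_ h''] _] _]; eauto.
Qed.

Lemma acts_in_transitive (phi x y : M) : acts phi x y -> in_transitive x.
Proof. intros (T & f & hT & tT & hx & _); exists T; auto. Qed.

(** Two witnesses of the recursion agree wherever both are defined, because foundation would give a
    minimal point of disagreement. *)
Lemma acts_unique (phi x y y' : M) : phi ∈ H -> acts phi x y -> acts phi x y' -> y = y'.
Proof.
  intros hp (T & f & hT & tT & hx & ff & fa & fs & h)
    (T' & f' & hT' & tT' & hx' & ff' & fa' & fs' & h').
  apply NNPP; intros n.
  destruct (@separation (fun u => u ∈ T' /\ exists v v', app f u v /\ app f' u v' /\ v <> v')
    ltac:(definability) T) as (N & _ & EN).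
  destruct (@foundation N) as (u & hu & hm).
  { exists x; apply EN; eauto 7. }
  apply EN in hu; destruct hu as (hu & hu' & v & v' & hv & hv' & hn); apply hn.
  destruct (classic (atom u)) as [a|s].
  - eapply function_on_unique; [apply (perm_function hp)| |]; eauto.
  - destruct (fs _ _ hv s) as [sv Ev], (fs' _ _ hv' s) as [sv' Ev'].
    apply extensionality; auto.
    assert (K : forall u' a b, u' ∈ u -> app f u' a -> app f' u' b -> a = b).
    { intros u' a b hu1 ha hb; apply NNPP; intros hab.
      apply (hm u'); [apply EN; split; [eauto|split; eauto]|exact hu1]. }
    intros z; rewrite Ev, Ev'; split; intros (u' & hu1 & hz); exists u'; split; auto.
    + destruct (@function_on_total f' T' u' ff' ltac:(eauto)) as [b hb].
      rewrite (K u' z b); auto.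
    + destruct (@function_on_total f T u' ff ltac:(eauto)) as [b hb].
      rewrite <- (K u' b z); auto.
Qed.

Lemma acts_member (phi x y u : M) : acts phi x y -> u ∈ x -> exists v, acts phi u v.
Proof.
  intros (T & f & hT & tT & hx & ff & fa & fs & h) hu.
  destruct (@function_on_total f T u ff (tT _ _ hx hu)) as [v hv].
  exists v, T, f; exact (conj hT (conj tT (conj (tT _ _ hx hu) (conj ff (conj fa (conj fs hv)))))).
Qed.

Lemma acts_atomE (phi x y : M) : acts phi x y -> atom x -> app phi x y.
Proof. intros (T & f & _ & _ & _ & _ & fa & _ & h) a; auto. Qed.

Lemma acts_setE (phi x y : M) : phi ∈ H -> acts phi x y -> isset x ->
  isset y /\ forall v, v ∈ y <-> exists u, u ∈ x /\ acts phi u v.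
Proof.
  intros hp h s; destruct (h) as (T & f & hT & tT & hx & ff & fa & fs & hf).
  destruct (fs _ _ hf s) as [sy Ey]; split; [exact sy|]; intros v; rewrite Ey.
  assert (K : forall u v, u ∈ x -> app f u v -> acts phi u v).
  { intros u v' hu hv; exists T, f.
    exact (conj hT (conj tT (conj (tT _ _ hx hu) (conj ff (conj fa (conj fs hv)))))). }
  split; intros (u & hu & hv); exists u; split; auto.
  destruct (@function_on_total f T u ff ltac:(eauto)) as [v' hv'].
  rewrite (acts_unique hp hv (K u v' hu hv')); exact hv'.
Qed.

Lemma acts_atom (phi x y : M) : phi ∈ H -> app phi x y -> acts phi x y.
Proof.
  intros hp h; destruct (perm_app_atom hp h) as [ax ay].
  (* [{x}] is transitive, since the atom [x] has no members. *)
  destruct (pair_ex x x) as [T [hT ET]].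
  destruct (@graph_ex (fun u v => app phi u v) ltac:(definability) T) as (f & hf & Ef).
  - intros u hu; apply ET in hu; destruct hu; subst; eauto.
  - intros u v v' _; apply (function_on_unique (perm_function hp)).
  - exists T, f.
    split; [exact hT|split; [|split; [apply ET; auto|split; [exact hf|split; [|split]]]]].
    + intros u v hu hv; apply ET in hu; destruct hu; subst; destruct (atom_empty ax hv).
    + intros u v huv _; apply Ef in huv; tauto.
    + intros u v huv s; apply Ef in huv; destruct huv as [hu _]; apply ET in hu.
      destruct hu; subst; destruct (s ax).
    + apply Ef; split; [apply ET; auto|exact h].
Qed.

(** Converse of [acts_setE]: the action already defined on the members of [x], extended by the value
    [y] at [x], is a witness of the recursion. *)
Lemma acts_set (phi x y : M) : phi ∈ H -> isset x -> isset y ->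
  (forall u, u ∈ x -> exists v, v ∈ y /\ acts phi u v) ->
  (forall v, v ∈ y -> exists u, u ∈ x /\ acts phi u v) -> acts phi x y.
Proof.
  intros hp sx sy hxy hyx.
  (* In case the action is already defined at [x], its value there is [y], so that the graph [f]
     below stays functional. *)
  assert (Kx : forall v, acts phi x v -> v = y).
  { intros v hv; destruct (acts_setE hp hv sx) as [sv Ev].
    apply extensionality; auto; intros z; rewrite Ev; split; [|auto].
    intros (u & hu & hz); destruct (hxy u hu) as (z' & hz' & h).
    rewrite (acts_unique hp hz h); exact hz'. }
  destruct (@in_transitive_intro x) as (T0 & hT0 & tT0 & hx).
  { intros u hu; destruct (hxy u hu) as (v & _ & hv); eapply acts_in_transitive; eauto. }
  destruct (@separation (fun z => z = x \/ exists v, acts phi z v)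
    ltac:(definability) T0) as (T & hT & ET).
  destruct (@graph_ex (fun z v => acts phi z v \/ (z = x /\ v = y))
    ltac:(definability) T) as (f & hf & Ef).
  { intros u hu; apply ET in hu; destruct hu as [_ [->|[v hv]]]; eauto. }
  { intros u v v' _ [h|[-> ->]] [h'|[E ->]]; subst; auto.
    - eapply acts_unique; eauto.
    - symmetry; auto. }
  assert (tT : forall u u', u ∈ T -> u' ∈ u -> u' ∈ T).
  { intros u u' hu hu'; apply ET in hu; destruct hu as [hu h]; apply ET.
    split; [eauto|right]; destruct h as [->|[v hv]].
    - destruct (hxy u' hu') as (v & _ & hv); eauto.
    - eapply acts_member; eauto. }
  assert (xT : x ∈ T) by (apply ET; auto).
  exists T, f; split; [exact hT|split; [exact tT|split; [exact xT|split; [exact hf|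
    split; [|split]]]]].
  - intros u v h a; apply Ef in h; destruct h as [_ [h|[-> _]]]; [|destruct (sx a)].
    apply (acts_atomE h a).
  - intros u v h s; apply Ef in h; destruct h as [hu h].
    assert (K : forall v', (exists u', u' ∈ u /\ app f u' v') <->
       exists u', u' ∈ u /\ acts phi u' v').
    { intros v'; split; intros (u' & hu' & h'); exists u'; split; auto.
      - apply Ef in h'; destruct h' as [_ [h'|[-> ->]]]; [exact h'|].
        destruct h as [h|[-> _]]; [|destruct (mem_irrefl hu')].
        destruct (acts_member h hu') as [w hxw]; rewrite (Kx w hxw) in hxw; exact hxw.
      - apply Ef; eauto. }
    destruct h as [h|[-> ->]].
    + destruct (acts_setE hp h s) as [sv Ev]; split; [exact sv|].
      intros v'; rewrite Ev, K; tauto.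
    + split; [exact sy|]; intros v'; rewrite K; split; [auto|].
      intros (u' & hu' & h'); destruct (hxy u' hu') as (z & hz & hz').
      rewrite (acts_unique hp h' hz'); exact hz.
  - apply Ef; auto.
Qed.

Lemma acts_total (phi x : M) : phi ∈ H -> in_transitive x -> exists y, acts phi x y.
Proof.
  intros hp; revert x; refine (@in_transitive_ind (fun x => _) _ _); [definability|].
  intros x hx IH; destruct (classic (atom x)) as [a|s].
  - destruct (perm_app hp a) as [y hy]; exists y; apply acts_atom; auto.
  - destruct (@replacement (fun u v => acts phi u v) ltac:(definability) x)
      as (y & hy & Ey); [intros; eapply acts_unique; eauto|].
    exists y; apply acts_set; auto.
    + intros u hu; destruct (IH u hu) as [v hv]; exists v; rewrite Ey; eauto.
    + intros v hv; apply Ey, hv.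
Qed.

Lemma acts_isset (phi x y : M) : phi ∈ H -> acts phi x y -> (isset x <-> isset y).
Proof.
  intros hp h; destruct (classic (atom x)) as [a|s].
  - pose proof (perm_app_atom hp (acts_atomE h a)); unfold isset; tauto.
  - destruct (acts_setE hp h s); tauto.
Qed.

Lemma acts_identity (i : M) : i ∈ H -> is_identity A i ->
  forall x : M, in_transitive x -> acts i x x.
Proof.
  intros hi [_ hid]; refine (@in_transitive_ind (fun x => _) _ _); [definability|].
  intros x hx IH; destruct (classic (atom x)) as [a|s].
  - apply acts_atom; auto; apply hid, hA, a.
  - apply acts_set; eauto.
Qed.

Lemma acts_comp (f g h x y z : M) : f ∈ H -> g ∈ H -> h ∈ H -> is_comp A h g f ->
  acts f x y -> acts g y z -> acts h x z.
Proof.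
  intros hf hg hh [_ c].
  enough (K : forall x, in_transitive x ->
    forall y z, acts f x y -> acts g y z -> acts h x z).
  { intros hx; apply (K x (acts_in_transitive hx)); exact hx. }
  clear x y z; refine (@in_transitive_ind (fun x => _) _ _); [definability|].
  intros x _ IH y z hxy hyz; destruct (classic (atom x)) as [a|s].
  - apply acts_atom; auto; apply acts_atomE in hxy; auto.
    apply acts_atomE in hyz; [eauto|]; apply (perm_app_atom hf hxy).
  - destruct (acts_setE hf hxy s) as [sy Ey], (acts_setE hg hyz sy) as [sz Ez].
    apply acts_set; auto.
    + intros u hu; destruct (acts_member hxy hu) as [v hv].
      assert (hvy : v ∈ y) by (apply Ey; eauto).
      destruct (acts_member hyz hvy) as [v' hv']; exists v'; rewrite Ez; eauto.
    + intros v' hv'; apply Ez in hv'; destruct hv' as (v & hv & hv').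
      apply Ey in hv; destruct hv as (u & hu & hv); eauto.
Qed.

Lemma acts_inverse (f g x y : M) : f ∈ H -> g ∈ H -> is_inverse A g f ->
  (acts f x y <-> acts g y x).
Proof.
  assert (K : forall f g, f ∈ H -> g ∈ H -> (forall a b, app f a b -> app g b a) ->
    forall x, in_transitive x -> forall y, acts f x y -> acts g y x).
  { clear f g x y; intros f g hf hg i.
    refine (@in_transitive_ind (fun x => _) _ _); [definability|].
    intros x _ IH y hxy; destruct (classic (atom x)) as [a|s].
    - apply acts_atom; auto; apply i, acts_atomE; auto.
    - destruct (acts_setE hf hxy s) as [sy Ey]; apply acts_set; auto.
      + intros v hv; apply Ey in hv; destruct hv as (u & hu & hv); eauto.
      + intros u hu; destruct (acts_member hxy hu) as [v hv].
        exists v; rewrite Ey; eauto. }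
  intros hf hg [gf i].
  split; intros h; [exact (K f g hf hg i x (acts_in_transitive h) y h)|].
  refine (K g f hg hf _ y (acts_in_transitive h) x h).
  (* [is_inverse] gives one implication between the graphs; the other follows from the surjectivity
     of [f]. *)
  intros b a hba; destruct hH as (_ & hperm & _); destruct (hperm f hf) as [_ surj].
  destruct (surj b) as [a' ha']; [eapply function_on_dom; eauto|].
  rewrite (function_on_unique gf hba (i _ _ ha')); exact ha'.
Qed.

Lemma group_id : exists i, i ∈ H /\ forall x : M, in_transitive x -> acts i x x.
Proof.
  destruct (hH) as (_ & _ & (i & hi & hid) & _); exists i; split; [exact hi|].
  apply acts_identity; auto.
Qed.

Lemma group_comp (f g : M) : f ∈ H -> g ∈ H ->
  exists h, h ∈ H /\ forall x y z, acts f x y -> acts g y z -> acts h x z.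
Proof.
  intros hf hg; destruct (hH) as (_ & _ & _ & hc & _).
  destruct (hc f g hf hg) as (h & hh & c); exists h; split; [exact hh|].
  intros x y z; apply acts_comp; auto.
Qed.

Lemma group_inverse (f : M) : f ∈ H ->
  exists g, g ∈ H /\ forall x y, acts f x y <-> acts g y x.
Proof.
  intros hf; destruct (hH) as (_ & _ & _ & _ & hi).
  destruct (hi f hf) as (g & hg & i); exists g; split; [exact hg|].
  intros x y; apply acts_inverse; auto.
Qed.

(** * The action as an automorphism: membership, ordered pairs, functions and injections *)

Lemma acts_image (phi x y : M) : phi ∈ H -> acts phi x y -> in_transitive y.
Proof.
  intros hp h; destruct (group_inverse hp) as (g & _ & hg).
  apply hg in h; eapply acts_in_transitive; eauto.
Qed.

Lemma acts_inj (phi x x' y : M) : phi ∈ H -> acts phi x y -> acts phi x' y -> x = x'.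
Proof.
  intros hp h h'; destruct (group_inverse hp) as (g & hgH & hg).
  apply hg in h, h'; eapply acts_unique; eauto.
Qed.

Lemma acts_mem (phi x y u v : M) : phi ∈ H -> acts phi x y -> acts phi u v ->
  (u ∈ x <-> v ∈ y).
Proof.
  intros hp h h'; destruct (classic (isset x)) as [s|a].
  - destruct (acts_setE hp h s) as [_ E]; rewrite E; split; [eauto|].
    intros (u' & hu & h2); rewrite (acts_inj hp h' h2); exact hu.
  - pose proof (acts_isset hp h) as i.
    split; intros m; exfalso; pose proof (isset_mem m); tauto.
Qed.

Lemma acts_pair (phi p p' x x' y y' : M) : phi ∈ H -> is_pair p x y -> is_pair p' x' y' ->
  acts phi x x' -> acts phi y y' -> acts phi p p'.
Proof.
  intros hp [s E] [s' E'] hx hy; apply acts_set; auto.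
  - intros u hu; apply E in hu; destruct hu; subst; [exists x'|exists y']; rewrite E'; auto.
  - intros u hu; apply E' in hu; destruct hu; subst; [exists x|exists y]; rewrite E; auto.
Qed.

Lemma acts_opair (phi p p' x x' y y' : M) : phi ∈ H -> is_opair p x y -> is_opair p' x' y' ->
  acts phi x x' -> acts phi y y' -> acts phi p p'.
Proof.
  intros hp (u & v & hu & hv & huv) (u' & v' & hu' & hv' & huv') hx hy.
  eapply acts_pair; eauto; eapply acts_pair; eauto.
Qed.

Lemma in_transitive_opair (p x y : M) : in_transitive p -> is_opair p x y ->
  in_transitive x /\ in_transitive y.
Proof.
  intros hp (u & v & [_ hu] & [_ hv] & [_ huv]).
  assert (hv' : in_transitive v) by (apply (in_transitive_mem hp), huv; auto).
  split; apply (in_transitive_mem hv'), hv; auto.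
Qed.

Lemma acts_opairE (phi p p' x y : M) : phi ∈ H -> acts phi p p' -> is_opair p x y ->
  exists x' y', is_opair p' x' y' /\ acts phi x x' /\ acts phi y y'.
Proof.
  intros hp h o; destruct (in_transitive_opair (acts_in_transitive h) o) as [hx hy].
  destruct (acts_total hp hx) as [x' hx'], (acts_total hp hy) as [y' hy'].
  exists x', y'; destruct (opair_ex x' y') as [q hq]; split; [|auto].
  rewrite (acts_unique hp h (acts_opair hp o hq hx' hy')); exact hq.
Qed.

Lemma acts_app (phi f f' x y : M) : phi ∈ H -> acts phi f f' -> app f x y ->
  exists x' y', acts phi x x' /\ acts phi y y' /\ app f' x' y'.
Proof.
  intros hp h (p & o & hpf).
  destruct (acts_total hp (in_transitive_mem (acts_in_transitive h) hpf)) as [p' hp'].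
  destruct (acts_opairE hp hp' o) as (x' & y' & o' & hx & hy).
  exists x', y'; split; [auto|split; [auto|]]; exists p'; split; [exact o'|].
  apply (acts_mem hp h hp'), hpf.
Qed.

Lemma acts_function (phi f f' x x' y y' : M) : phi ∈ H ->
  acts phi f f' -> acts phi x x' -> acts phi y y' -> function f x y -> function f' x' y'.
Proof.
  intros hp hf hx hy [ff fy]; destruct (group_inverse hp) as (g & hg & i).
  (* Every pair of [f'] comes from a pair of [f], by the action of the inverse permutation. *)
  assert (back : forall u' v', app f' u' v' ->
    exists u v, acts phi u u' /\ acts phi v v' /\ app f u v).
  { intros u' v' h; destruct (acts_app hg (proj1 (i _ _) hf) h) as (u & v & hu & hv & h').
    exists u, v; rewrite !i; auto. }
  split; [split; [|split]|].
  - apply (acts_isset hp hf), ff.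
  - intros p' hp'; pose proof (acts_setE hp hf (proj1 ff)) as [_ Ef'].
    apply Ef' in hp'; destruct hp' as (p & hpf & hpp).
    destruct ff as (_ & ff & _); destruct (ff p hpf) as (u & v & hu & o).
    destruct (acts_opairE hp hpp o) as (u' & v' & o' & hu' & _).
    exists u', v'; split; [apply (acts_mem hp hx hu'), hu|exact o'].
  - intros u' hu'.
    destruct (@acts_total g u' hg) as [u hu].
    { eapply in_transitive_mem; [eapply acts_image; [exact hp|exact hx]|exact hu']. }
    apply i in hu; apply (acts_mem hp hx hu) in hu'.
    destruct (function_on_total ff hu') as [v hv].
    destruct (acts_app hp hf hv) as (u1 & v' & h1 & h2 & h3).
    rewrite (acts_unique hp h1 hu) in h3; exists v'; split; [exact h3|].
    intros v2 h; destruct (back _ _ h) as (u3 & v3 & h4 & h5 & h6).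
    rewrite (acts_inj hp h4 hu) in h6.
    rewrite (function_on_unique ff h6 hv) in h5; exact (acts_unique hp h2 h5).
  - intros u' v' h; destruct (back _ _ h) as (u & v & _ & hv & huv).
    apply (acts_mem hp hy hv); eauto.
Qed.

Lemma acts_injection (phi f f' x x' y y' : M) : phi ∈ H ->
  acts phi f f' -> acts phi x x' -> acts phi y y' -> injection f x y -> injection f' x' y'.
Proof.
  intros hp hf hx hy [ff inj]; split; [eapply acts_function; eauto|].
  destruct (group_inverse hp) as (g & hg & i).
  intros u u' v h h'.
  destruct (acts_app hg (proj1 (i _ _) hf) h) as (a & b & ha & hb & hab).
  destruct (acts_app hg (proj1 (i _ _) hf) h') as (a' & b' & ha' & hb' & hab').
  rewrite (acts_unique hg hb' hb) in hab'; rewrite (inj _ _ _ hab hab') in ha.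
  eapply (acts_inj hg); eauto.
Qed.

(** * Sets fixed by a group *)

Lemma fixes_pointwise (x : M) : isset x -> (forall u, u ∈ x -> fixes H u) -> fixes H x.
Proof.
  intros s h phi hp; apply acts_set; auto; intros u hu; exists u; split; auto;
    apply h; auto.
Qed.

(** It suffices that each element of [H] maps [x] into [x]: applied to the inverse, this also makes
    the map onto. *)
Lemma fixes_closed (x : M) : isset x ->
  (forall phi u, phi ∈ H -> u ∈ x -> exists v, v ∈ x /\ acts phi u v) -> fixes H x.
Proof.
  intros s h phi hp; destruct (group_inverse hp) as (g & hg & i).
  apply acts_set; auto; intros v hv.
  destruct (h g v hg hv) as (u & hu & hvu); exists u; split; [auto|]; apply i, hvu.
Qed.

Lemma fixes_opair (p x y : M) : is_opair p x y -> fixes H x -> fixes H y -> fixes H p.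
Proof. intros o hx hy phi hp; eapply acts_opair; eauto. Qed.

Lemma fixes_relation (f : M) : isset f ->
  (forall p, p ∈ f -> exists u v, is_opair p u v) ->
  (forall u v, app f u v -> fixes H u /\ fixes H v) -> fixes H f.
Proof.
  intros s hp h; apply fixes_pointwise; auto; intros p hpf.
  destruct (hp p hpf) as (u & v & o).
  destruct (h u v) as [hu hv]; [exists p; auto|]; eapply fixes_opair; eauto.
Qed.

Lemma fixes_value (f x u v : M) : function_on f x -> fixes H f -> fixes H u ->
  app f u v -> fixes H v.
Proof.
  intros ff hf hu h phi hp; destruct (acts_app hp (hf phi hp) h) as (u' & v' & h1 & h2 & h3).
  rewrite (acts_unique hp h1 (hu phi hp)) in h3.
  rewrite (function_on_unique ff h3 h) in h2; exact h2.
Qed.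

(** An element is determined by its value, and the value does not move. Hence a support of an
    enumeration of a countable set supports all its elements at once. *)
Lemma fixes_domain (f x y u : M) : injection f x y -> fixes H f ->
  (forall v, v ∈ y -> fixes H v) -> u ∈ x -> fixes H u.
Proof.
  intros [[ff fy] inj] hf hy hu phi hp; destruct (function_on_total ff hu) as [v hv].
  destruct (acts_app hp (hf phi hp) hv) as (u' & v' & h1 & h2 & h3).
  rewrite (acts_unique hp h2 (hy v (fy _ _ hv) phi hp)) in h3.
  rewrite (inj _ _ _ h3 hv) in h1; exact h1.
Qed.

Lemma fixes_nat (w n : M) : is_omega w -> n ∈ w -> fixes H n.
Proof.
  intros hw; revert n; refine (@omega_ind w hw (fun n => _) _ _ _); [definability| |].
  - intros o [s ho]; apply fixes_pointwise; auto; intros u hu; destruct (ho u hu).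
  - intros n s hn IH [hs Es]; apply fixes_closed; auto; intros phi u hp hu.
    apply Es in hu; destruct hu as [hu| ->]; [|exists n; rewrite Es; auto].
    destruct (acts_total hp (in_transitive_mem (acts_in_transitive (IH phi hp)) hu))
      as [v hv].
    exists v; rewrite Es; split; [left|exact hv].
    apply (acts_mem hp (IH phi hp) hv), hu.
Qed.

Lemma fixes_omega (w : M) : is_omega w -> fixes H w.
Proof.
  intros hw; apply fixes_pointwise; [apply hw|]; intros n; apply fixes_nat, hw.
Qed.

End Action.

(** * Hereditarily symmetric sets *)

Section Symmetric.
Context (G F B : M) (hG : perm_group A G) (hB : filter_base A G B)
  (hgen : generated_by A G B F).

Notation HS := (hereditarily_symmetric G F).

Lemma base_perm_group (b : M) : b ∈ B -> perm_group A b.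
Proof. destruct hB as (_ & _ & h & _); intros hb; apply (h b hb). Qed.

Lemma base_sub (b phi : M) : b ∈ B -> phi ∈ b -> phi ∈ G.
Proof. destruct hB as (_ & _ & h & _); intros hb; apply (h b hb). Qed.

Lemma base_ex : exists b, b ∈ B.
Proof. destruct hB as (_ & h & _); exact h. Qed.

Lemma base_meet (b c : M) : b ∈ B -> c ∈ B -> exists d, d ∈ B /\
  (forall x, fixes b x -> fixes d x) /\ (forall x, fixes c x -> fixes d x).
Proof.
  destruct hB as (_ & _ & _ & h); intros hb hc; destruct (h b c hb hc) as (d & hd & s & s').
  exists d; split; [exact hd|]; split; intros x hx phi hp; auto.
Qed.

Lemma fixes_in_transitive (b x : M) : b ∈ B -> fixes b x -> in_transitive x.
Proof.
  intros hb h; destruct (base_perm_group hb) as (_ & _ & (i & hi & _) & _).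
  exact (acts_in_transitive (h i hi)).
Qed.

(** The stabilizer of [x] is a subgroup containing [b], hence lies in the generated filter. Together
    with [symmetric_support] this replaces the filter by supports taken from the base. *)
Lemma symmetric_intro (b x : M) : b ∈ B -> fixes b x -> symmetric G F x.
Proof.
  intros hb hx.
  destruct (@separation (fun phi => acts phi x x) ltac:(definability) G) as (K & hK & EK).
  exists K; split; [split; auto|]; apply hgen; split.
  - destruct (hG) as (_ & hperm & (i & hi & hid) & hcomp & hinv).
    assert (hsub : K ⊆ G) by (intros phi hp; apply EK in hp; tauto).
    split; [split; [exact hK|split; [auto|split; [|split]]]|exact hsub].
    + exists i; split; [|exact hid]; apply EK; split; [exact hi|].
      apply (acts_identity hG); auto; eapply fixes_in_transitive; eauto.
    + intros f g hf hg; apply EK in hf, hg; destruct hf as [hf h], hg as [hg h'].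
      destruct (hcomp f g hf hg) as (k & hk & c); exists k; split; [|exact c].
      apply EK; split; [exact hk|]; eapply (acts_comp hG hf hg hk); eauto.
    + intros f hf; apply EK in hf; destruct hf as [hf h].
      destruct (hinv f hf) as (g & hg & c); exists g; split; [|exact c].
      apply EK; split; [exact hg|]; apply (acts_inverse hG x x hf hg c), h.
  - exists b; split; [exact hb|]; intros phi hp; apply EK; split; auto.
    eapply base_sub; eauto.
Qed.

Lemma symmetric_support (x : M) : symmetric G F x -> exists b, b ∈ B /\ fixes b x.
Proof.
  intros (K & [_ EK] & hK); apply hgen in hK; destruct hK as (_ & b & hb & s).
  exists b; split; [exact hb|]; intros phi hp; apply EK; auto.
Qed.

Lemma HS_support (x : M) : HS x -> exists b, b ∈ B /\ fixes b x.
Proof. intros [h _]; apply symmetric_support, h. Qed.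

Lemma HS_in_transitive (x : M) : HS x -> in_transitive x.
Proof.
  intros h; destruct (HS_support h) as (b & hb & f); eapply fixes_in_transitive; eauto.
Qed.

Lemma HS_mem (x u : M) : HS x -> u ∈ x -> HS u.
Proof.
  intros [_ h] hu; split.
  - apply h; intros T _ _ s; auto.
  - intros z hz; apply h; intros T hT tT s; apply hz; auto.
    intros v hv; eapply tT; eauto.
Qed.

Lemma HS_intro (b x : M) : b ∈ B -> fixes b x -> (forall u, u ∈ x -> HS u) -> HS x.
Proof.
  intros hb hx h; split; [eapply symmetric_intro; eauto|]; intros z hz.
  destruct (fixes_in_transitive hb hx) as (T & hT & tT & xT).
  (* [T'] consists of the members of [x] and of their transitive closures; it is one of the
     transitive sets to which [in_tc z x] can be applied. *)
  destruct (@separation (fun z => exists u, u ∈ x /\ (z = u \/ in_tc z u))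
    ltac:(definability) T) as (T' & hT' & E).
  assert (zT : z ∈ T').
  { apply hz; [exact hT'| |].
    - intros y y' hy hy'; apply E in hy; destruct hy as (hy & u & hu & c); apply E.
      split; [eauto|]; exists u; split; [exact hu|right].
      intros S hS tS s; destruct c as [->|c]; [auto|]; eapply tS; [|exact hy'].
      apply c; auto.
    - intros u hu; apply E; split; [eauto|]; eauto. }
  apply E in zT; destruct zT as (_ & u & hu & [->|c]); destruct (h u hu); auto.
Qed.

Lemma HS_opair (b p x y : M) : b ∈ B -> is_opair p x y -> HS x -> HS y ->
  fixes b x -> fixes b y -> HS p.
Proof.
  intros hb (u & v & hu & hv & hp) sx sy hx hy; pose proof (base_perm_group hb) as hH.
  assert (K : forall q a c, is_pair q a c -> HS a -> HS c -> fixes b a -> fixes b c ->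
    HS q /\ fixes b q).
  { intros q a c [hq E] sa sc ha hc.
    assert (f : fixes b q).
    { apply (fixes_pointwise hH hq); intros z hz; apply E in hz; destruct hz; subst; auto. }
    split; [|exact f]; apply (HS_intro hb f).
    intros z hz; apply E in hz; destruct hz; subst; auto. }
  destruct (K u x x) as [su fu]; auto; destruct (K v x y) as [sv fv]; auto.
  apply (K p u v); auto.
Qed.

Lemma HS_function (b f x : M) : b ∈ B -> function_on f x ->
  (forall u v, app f u v -> (HS u /\ HS v) /\ fixes b u /\ fixes b v) -> HS f.
Proof.
  intros hb (sf & hp & _) h; apply (HS_intro hb).
  - apply (fixes_relation (base_perm_group hb) sf).
    + intros p hpf; destruct (hp p hpf) as (u & v & _ & o); eauto.
    + intros u v huv; apply h, huv.
  - intros p hpf; destruct (hp p hpf) as (u & v & _ & o).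
    destruct (h u v) as ([su sv] & fu & fv); [exists p; auto|].
    eapply HS_opair; eauto.
Qed.

(** * Omega in the permutation model and first consequences of condition (a) *)

Section OmegaSymmetric.
Context (w : M) (hw : is_omega w).

Lemma HS_nat (n : M) : n ∈ w -> HS n.
Proof.
  destruct base_ex as [b hb]; revert n.
  refine (@omega_ind w hw (fun n => _) _ _ _); [definability| |].
  - intros o ho; apply (HS_intro hb).
    + apply (fixes_nat (base_perm_group hb) hw), (empty_in_omega hw ho).
    + intros u hu; destruct ho as [_ ho]; destruct (ho u hu).
  - intros n s hn IH hs; apply (HS_intro hb).
    + apply (fixes_nat (base_perm_group hb) hw), (succ_in_omega hw hn hs).
    + intros u hu; apply hs in hu; destruct hu as [hu| ->]; [|exact IH].
      eapply HS_mem; eauto.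
Qed.

Lemma HS_omega : HS w.
Proof.
  destruct base_ex as [b hb]; apply (HS_intro hb); [|exact HS_nat].
  apply (fixes_omega (base_perm_group hb) hw).
Qed.

Lemma HS_injection (b f x : M) : b ∈ B -> injection f x w ->
  (forall u, u ∈ x -> HS u /\ fixes b u) -> HS f.
Proof.
  intros hb [[ff fw] _] h; apply (HS_function hb ff); intros u v huv.
  destruct (h u (function_on_dom ff huv)).
  pose proof (HS_nat (fw _ _ huv)).
  pose proof (fixes_nat (base_perm_group hb) hw (fw _ _ huv)); tauto.
Qed.

Context (hAC : models_AC M).
Context (ha : forall x b phi y : M, HS x -> b ∈ B -> phi ∈ G ->
  acts phi x y -> fixes b x -> fixes b y).

(** By (a) a support of [x] also supports its image; the members follow by induction. *)
Lemma HS_acts (phi x y : M) : phi ∈ G -> HS x -> acts phi x y -> HS y.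
Proof.
  intros hp; enough (K : forall x, in_transitive x -> HS x -> forall y, acts phi x y -> HS y).
  { intros hx; apply (K x (HS_in_transitive hx) hx). }
  clear x y; refine (@in_transitive_ind (fun x => _) _ _); [definability|].
  intros x _ IH hx y hxy; destruct (HS_support hx) as (b & hb & fx).
  apply (HS_intro hb); [eapply ha; eauto|]; intros v hv.
  destruct (classic (isset x)) as [s|n].
  - destruct (acts_setE hG hp hxy s) as [_ E]; apply E in hv.
    destruct hv as (u & hu & huv); eapply IH; eauto using HS_mem.
  - destruct n; apply (acts_isset hG hp hxy); eapply isset_mem; eauto.
Qed.

Lemma fixes_acts_inv (b phi x y : M) : b ∈ B -> phi ∈ G -> HS y ->
  acts phi x y -> fixes b y -> fixes b x.
Proof.
  intros hb hp hy h fy; destruct (group_inverse hG hp) as (g & hg & i).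
  apply i in h; eapply ha; eauto.
Qed.

(** [Y] is the part of [X] inside a union of full [G]-orbits, and [b] is a subgroup of [G]
    preserving [X]. The class [Q] covers both a single point and all points of a set. *)
Lemma fixes_saturation (b X Y : M) (Q : M -> Prop) : b ∈ B -> fixes b X -> isset Y ->
  (forall v, v ∈ Y <-> v ∈ X /\ exists phi u, phi ∈ G /\ Q u /\ acts phi u v) ->
  fixes b Y.
Proof.
  intros hb hX sY E; pose proof (base_perm_group hb) as hH.
  apply (fixes_closed hH sY); intros psi v hpsi hv; apply E in hv.
  destruct hv as (hv & phi & u & hp & hu & huv).
  destruct (acts_member (hX psi hpsi) hv) as [z hz]; exists z; split; [|exact hz].
  apply E; split; [apply (acts_mem hH hpsi (hX psi hpsi) hz), hv|].
  destruct (group_comp hG hp (base_sub hb hpsi)) as (k & hk & c).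
  exists k, u; eauto.
Qed.

(** The external forms of the notions of the permutation model: see
    [val_countable], [val_choice], [val_CAC] and [val_in_C]. *)
Definition HS_countable (x : M) : Prop :=
  isset x /\ exists f, HS f /\ injection f x w.
Definition HS_choice (x : M) : Prop :=
  exists f, HS f /\ function_on f x /\ forall u v, app f u v -> v ∈ u.
Definition HS_CAC (Y : M) : Prop :=
  forall K, HS K -> HS_countable K ->
    (forall k, k ∈ K -> isset k /\ nonempty k /\ k ⊆ Y) -> HS_choice K.

(** * Choice for the power [X^omega], seen from [M] *)

Lemma HS_CAC_omega_power (X P : M) : HS X -> HS_CAC X ->
  (forall f, f ∈ P <-> HS f /\ function f w X) -> HS_CAC P.
Proof.
  intros sX cX EP K sK (_ & h & sh & hinj) hK.
  destruct (@choice_function hAC (fun k f => f ∈ k) ltac:(definability) K P)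
    as (c0 & [fc0 c0P] & hc0).
  { intros k hk; destruct (hK k hk) as (_ & [f hf] & s); exists f; auto. }
  destruct (HS_support sX) as (b1 & hb1 & fX), (HS_support sh) as (b2 & hb2 & fh).
  (* The variable [u] equal to [t] gives [orb] the shape required by [fixes_saturation]. *)
  pose (orb (t O : M) := forall v, v ∈ O <->
    v ∈ X /\ exists phi u, phi ∈ G /\ u = t /\ acts phi u v).
  assert (orb_ex : forall t, exists O, isset O /\ orb t O).
  { intros t; apply separation; definability. }
  destruct (power_ex X) as (PX & _ & EPX).
  destruct (@separation (fun O => exists k f i t,
     k ∈ K /\ app c0 k f /\ app f i t /\ orb t O) ltac:(unfold orb; definability) PX)
     as (K' & sK' & EK').
  assert (K'e : forall O, O ∈ K' -> isset O /\ O ⊆ X /\ exists k f i t,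
     k ∈ K /\ app c0 k f /\ app f i t /\ orb t O).
  { intros O hO; apply EK' in hO; destruct hO as [hO h']; apply EPX in hO; tauto. }
  assert (K'f : forall O, O ∈ K' -> fixes b1 O).
  { intros O hO; destruct (K'e O hO) as (sO & _ & k & f & i & t & _ & _ & _ & E).
    exact (fixes_saturation hb1 fX sO E). }
  assert (K'h : forall O, O ∈ K' -> HS O).
  { intros O hO; apply (HS_intro hb1 (K'f O hO)); intros u hu.
    apply (HS_mem sX); apply (K'e O hO), hu. }
  assert (HK' : HS K').
  { apply (HS_intro hb1); [|exact K'h].
    apply (fixes_pointwise (base_perm_group hb1) sK'), K'f. }
  assert (val : forall k f i t, app c0 k f -> app f i t -> HS f /\ function f w X /\ t ∈ X).
  { intros k f i t h1 h2; apply c0P, EP in h1; destruct h1 as [sf [ff fX']].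
    exact (conj sf (conj (conj ff fX') (fX' _ _ h2))). }
  (* The orbit of [f_k(j)] is named by the number [h(k)] and by [j]. *)
  destruct (@injection_omega_ex hAC w hw (fun i j O => exists k f t,
     app h k i /\ app c0 k f /\ app f j t /\ orb t O)
     ltac:(unfold orb; definability) K') as (j & hj).
  { intros O hO; destruct (K'e O hO) as (_ & _ & k & f & i & t & hk & h1 & h2 & E).
    destruct (hinj) as [[fh' hw'] _]; destruct (function_on_total fh' hk) as [n hn].
    destruct (val _ _ _ _ h1 h2) as (_ & [ff _] & _).
    exists n, i; split; [eauto|]; split; [eapply function_on_dom; eauto|].
    exists k, f, t; auto. }
  { intros i l O O' hO hO' (k & f & t & h1 & h2 & h3 & E) (k' & f' & t' & h1' & h2' & h3' & E').
    destruct hinj as [_ inj]; rewrite (inj _ _ _ h1' h1) in h2'.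
    rewrite (function_on_unique fc0 h2' h2) in h3'.
    destruct (val _ _ _ _ h2 h3) as (_ & [ff _] & _).
    rewrite (function_on_unique ff h3' h3) in E'.
    apply extensionality; [apply (K'e O hO)|apply (K'e O' hO')|].
    intros z; rewrite (E z), (E' z); tauto. }
  destruct (cX K' HK') as (c & sc & fc & hc).
  { split; [exact sK'|]; exists j; split; [|exact hj]; apply (HS_injection hb1 hj); auto. }
  { intros O hO; destruct (K'e O hO) as (sO & s & k & f & i & t & hk & h1 & h2 & E).
    split; [exact sO|]; split; [|exact s]; exists t.
    destruct (val _ _ _ _ h1 h2) as (_ & _ & ht).
    apply E; split; [exact ht|]; destruct (group_id hG) as (e & he & i').
    exists e, t; repeat split; auto; apply i', HS_in_transitive, (HS_mem sX ht). }
  (* The final [b] supports [X], the enumeration [h] of [K] and the choice function [c] on the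
     orbits. *)
  destruct (HS_support sc) as (b3 & hb3 & f3), (base_meet hb1 hb2) as (b4 & hb4 & m1 & m2).
  destruct (base_meet hb3 hb4) as (b & hb & m3 & m4).
  pose proof (base_perm_group hb) as hH.
  exists c0; split; [|split; auto]; apply (HS_function hb fc0); intros k f hkf.
  pose proof (function_on_dom fc0 hkf) as hk.
  pose proof (proj1 (EP f) (c0P _ _ hkf)) as [sf [ff fw]].
  split; [split; [apply (HS_mem sK hk)|exact sf]|]; split.
  - apply (fixes_domain hH hinj); auto; intros n hn; apply (fixes_nat hH hw hn).
  - apply (fixes_relation hH); [apply ff| |].
    + intros p hp; destruct ff as (_ & ff & _); destruct (ff p hp) as (u & v & _ & o); eauto.
    + intros i t hit; split; [apply (fixes_nat hH hw), (function_on_dom ff hit)|].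
      destruct (orb_ex t) as (O & sO & EO).
      assert (hO : O ∈ K').
      { apply EK'; split; [apply EPX; split; [exact sO|]|exists k, f, i, t; auto].
        intros z hz; apply EO in hz; tauto. }
      (* [c] and the orbit [O] of [t] are fixed by [b], so the chosen point [v] is fixed too, and
         (a) carries this back from [v] to [t]. *)
      destruct (function_on_total fc hO) as [v hv].
      pose proof (proj1 (EO v) (hc _ _ hv)) as (hvX & phi & u & hp & -> & huv).
      apply (fixes_acts_inv hb hp (HS_mem sX hvX) huv).
      exact (fixes_value hH fc (m3 _ f3) (m4 _ (m1 _ (K'f O hO))) hv).
Qed.

(** * The principle [PS_0(II)], seen from [M], using condition (b) *)

Context (hb : forall x, HS x -> exists O, is_orbit G x O /\ HS_countable O).

Definition HS_in_C (X An x : M) : Prop :=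
  HS x /\ HS_countable x /\ x ⊆ X /\ forall z, z ∈ An -> exists t, t ∈ x /\ t ∈ z.

(** If [f] sends [u] to [k], then [phi(u)] is the only point sent to [k] by the conjugate [phi(f)].
    It is therefore named by [k] and the index of [phi(f)] in the orbit of [f], which is countable
    by (b). *)
Lemma HS_countable_saturation (X x Y : M) : HS x -> HS_countable x -> isset Y ->
  (forall v, v ∈ Y <-> v ∈ X /\ exists phi u, phi ∈ G /\ u ∈ x /\ acts phi u v) ->
  HS_countable Y.
Proof.
  intros sx (_ & f & sf & hf) sY E; split; [exact sY|].
  destruct (HS_support sf) as (b & hbB & fb); pose proof (base_perm_group hbB) as hH.
  destruct (hb sf) as (O & [_ EO] & _ & e & se & [[fe we] inj]).
  assert (img : forall f', f' ∈ O -> forall v v' n, app f' v n -> app f' v' n -> v = v').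
  { intros f' hf'; apply EO in hf'; destruct hf' as (phi & hp & h).
    destruct (acts_total hG hp (HS_in_transitive sx)) as [x' hx'].
    apply (acts_injection hG hp h hx' (fixes_omega hG hw hp) hf). }
  destruct (@injection_omega_ex hAC w hw
    (fun i k v => exists f', app e f' i /\ app f' v k) ltac:(definability) Y) as (j & hj).
  { intros v hv; apply E in hv; destruct hv as (_ & phi & u & hp & hu & huv).
    destruct hf as [[ff fw] _]; destruct (function_on_total ff hu) as [k hk].
    destruct (acts_total hG hp (HS_in_transitive sf)) as [f' hf'].
    assert (hO : f' ∈ O) by (apply EO; eauto).
    destruct (function_on_total fe hO) as [i hi].
    destruct (acts_app hG hp hf' hk) as (v' & k' & h1 & h2 & h3).
    rewrite (acts_unique hG hp h1 huv) in h3.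
    rewrite (acts_unique hG hp h2 (fixes_nat hG hw (fw _ _ hk) hp)) in h3.
    exists i, k; repeat split; eauto. }
  { intros i k v v' _ _ (f1 & h1 & h2) (f2 & h1' & h2').
    rewrite (inj _ _ _ h1' h1) in h2'.
    eapply img; eauto; eapply function_on_dom; eauto. }
  (* The injection [j] was chosen in [M]. It lies in the permutation model because [b] fixes every
     point of [Y]: the points of [x] by [fixes_domain], their images by (a). *)
  exists j; split; [|exact hj]; apply (HS_injection hbB hj); intros v hv.
  apply E in hv; destruct hv as (_ & phi & u & hp & hu & huv).
  pose proof (HS_mem sx hu) as su; split; [exact (HS_acts hp su huv)|].
  apply (ha su hbB hp huv), (fixes_domain hH hf fb); auto.
  intros n hn; apply (fixes_nat hH hw hn).
Qed.

Lemma HS_PS0_II (X a : M) : HS X -> HS a -> function_on a w ->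
  (forall n An, app a n An -> exists x, HS_in_C X An x) ->
  exists K, HS K /\ isset K /\
    (forall C, C ∈ K <-> isset C /\ exists n An, n ∈ w /\ app a n An /\
       forall x, x ∈ C <-> HS_in_C X An x) /\
    HS_choice K.
Proof.
  intros sX sa fa hne.
  destruct (HS_support sX) as (b1 & hb1 & f1), (HS_support sa) as (b2 & hb2 & f2).
  destruct (base_meet hb1 hb2) as (b & hbB & m1 & m2).
  pose proof (m1 _ f1) as fX; pose proof (m2 _ f2) as fa'.
  pose proof (base_perm_group hbB) as hH; clear b1 hb1 f1 b2 hb2 f2 m1 m2.
  pose (Q (C : M) := exists n An, n ∈ w /\ app a n An /\ forall x, x ∈ C <-> HS_in_C X An x).
  (* Each [C_n] is a set of subsets of [X], so the double power set bounds the family [K]. *)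
  destruct (power_ex X) as (PX & _ & EPX), (power_ex PX) as (PPX & _ & EPPX).
  assert (D : definable1 Q) by (unfold Q, HS_in_C, HS_countable; definability).
  destruct (separation D PPX) as (K & sK & EK0).
  assert (sub : forall C n An, (forall x, x ∈ C <-> HS_in_C X An x) -> app a n An -> C ⊆ PX).
  { intros C n An E _ x hx; apply E in hx; destruct hx as (_ & [s _] & h & _); apply EPX; auto. }
  assert (EK : forall C, C ∈ K <-> isset C /\ Q C).
  { intros C; rewrite EK0, EPPX; split; [tauto|]; intros [s q]; split; [|exact q].
    split; [exact s|]; destruct q as (n & An & _ & h & E); exact (sub C n An E h). }
  (* [C_n] is defined from [X] and [A_n], both fixed by [b]; the latter is the value of the fixed
     sequence [a] at the fixed number [n]. *)
  assert (Kf : forall C, C ∈ K -> fixes b C).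
  { intros C hC; apply EK in hC; destruct hC as (sC & n & An & hn & hA' & E).
    apply (fixes_closed hH sC); intros phi x hp hx; apply E in hx.
    destruct hx as (sx & (ix & f & sf & hf) & hxX & hm).
    pose proof (base_sub hbB hp) as hpG.
    destruct (acts_total hG hpG (HS_in_transitive sx)) as [y hy].
    destruct (acts_total hG hpG (HS_in_transitive sf)) as [f' hf'].
    exists y; split; [|exact hy]; apply E.
    split; [exact (HS_acts hpG sx hy)|]; split; [split|split].
    - apply (acts_isset hG hpG hy), ix.
    - exists f'; split; [exact (HS_acts hpG sf hf')|].
      apply (acts_injection hG hpG hf' hy (fixes_omega hG hw hpG) hf).
    - intros v hv; destruct (acts_setE hG hpG hy ix) as [_ Ey]; apply Ey in hv.
      destruct hv as (u & hu & huv); apply (acts_mem hG hpG (fX phi hp) huv); auto.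
    (* With [g] inverse to [phi], the set [g(z)] is again in [A_n], so [x] meets it in some [t], and
       [phi(t)] lies in both [y] and [z]. *)
    - intros z hz; destruct (group_inverse hH hp) as (g & hg & i).
      assert (fAn : fixes b An).
      { exact (fixes_value hH fa fa' (fixes_nat hH hw hn) hA'). }
      destruct (acts_member (fAn g hg) hz) as [z0 hz0].
      pose proof (proj1 (acts_mem hH hg (fAn g hg) hz0) hz) as hz0A; apply i in hz0.
      destruct (hm z0 hz0A) as (t & htx & htz).
      destruct (acts_member hy htx) as [t' ht']; exists t'.
      rewrite <- (acts_mem hG hpG hy ht'), <- (acts_mem hG hpG hz0 ht'); auto. }
  assert (Kh : forall C, C ∈ K -> HS C).
  { intros C hC; apply (HS_intro hbB (Kf C hC)); intros x hx.
    apply EK in hC; destruct hC as (_ & n & An & _ & _ & E); apply E in hx; apply hx. }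
  exists K; split; [|split; [exact sK|split; [exact EK|]]].
  { apply (HS_intro hbB); [|exact Kh]; apply (fixes_pointwise hH sK), Kf. }
  destruct (@choice_function hAC (fun C x => x ∈ C) ltac:(definability) K PX)
    as (c0 & [fc0 _] & hc0).
  { intros C hC; apply EK in hC; destruct hC as (_ & n & An & _ & h & E).
    destruct (hne n An h) as [x hx]; apply E in hx; exists x; split; [|exact hx].
    exact (sub C n An E h x hx). }
  pose (sat_of (x Y : M) := isset Y /\
    forall v, v ∈ Y <-> v ∈ X /\ exists phi u, phi ∈ G /\ u ∈ x /\ acts phi u v).
  destruct (@graph_ex (fun C Y => exists x, app c0 C x /\ sat_of x Y)
    ltac:(unfold sat_of; definability) K) as (c & fc & Ec).
  { intros C hC; destruct (function_on_total fc0 hC) as [x hx].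
    destruct (@separation (fun v => exists phi u, phi ∈ G /\ u ∈ x /\ acts phi u v)
      ltac:(definability) X) as (Y & hY); exists Y, x; auto. }
  { intros C Y Y' _ (x & hx & sY & EY) (x' & hx' & sY' & EY').
    rewrite (function_on_unique fc0 hx' hx) in EY'.
    apply extensionality; auto; intros z; rewrite EY, EY'; tauto. }
  (* Saturating the chosen [x] makes it fixed by [b] and keeps it in [C]: it stays inside [X], still
     meets every set it met, and remains countable. *)
  assert (hc : forall C Y, app c C Y -> C ∈ K /\ fixes b Y /\ Y ∈ C).
  { intros C Y h; apply Ec in h; destruct h as (hC & x & hx & sY & EY).
    split; [exact hC|].
    assert (fY : fixes b Y) by exact (fixes_saturation hbB fX sY EY).
    split; [exact fY|]; apply hc0 in hx.
    apply EK in hC; destruct hC as (_ & n & An & _ & h & E); apply E in hx; apply E.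
    destruct hx as (sx & cx & hxX & hm).
    split; [apply (HS_intro hbB fY)|split; [|split]].
    - intros v hv; apply EY in hv; apply (HS_mem sX), hv.
    - eapply HS_countable_saturation; eauto.
    - intros v hv; apply EY in hv; apply hv.
    - intros z hz; destruct (hm z hz) as (t & ht & htz); exists t; split; [|exact htz].
      apply EY; split; [auto|]; destruct (group_id hG) as (e & he & i).
      exists e, t; split; [exact he|split; [exact ht|]].
      apply i, HS_in_transitive, (HS_mem sx ht). }
  exists c; split; [|split; [exact fc|intros C Y h; apply (hc C Y h)]].
  apply (HS_function hbB fc); intros C Y h; destruct (hc C Y h) as (hC & fY & hY).
  exact (conj (conj (Kh C hC) (HS_mem (Kh C hC) hY)) (conj (Kf C hC) fY)).
Qed.

(** * Absoluteness for the permutation model *)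

Notation N := (perm_model G F).
Notation val := (@proj1_sig M HS).

Lemma val_HS (x : N) : HS (val x).
Proof. exact (proj2_sig x). Qed.

(** Objects of the permutation model carry a proof of hereditary symmetry, which proof irrelevance
    makes immaterial. *)
Lemma val_inj (x y : N) : val x = val y -> x = y.
Proof.
  destruct x as [x hx], y as [y hy]; cbn; intros ->; f_equal; apply proof_irrelevance.
Qed.

Lemma val_surj (x : M) : HS x -> exists x' : N, val x' = x.
Proof. intros h; exists (exist _ x h); reflexivity. Qed.

(** The permutation model is a transitive class; the absoluteness of the bounded notions below rests
    on this. *)
Lemma val_mem (x : N) (u : M) : u ∈ val x -> exists u' : N, val u' = u.
Proof. intros h; apply val_surj, (HS_mem (val_HS x) h). Qed.

Lemma val_subset (x y : N) : x ⊆ y <-> val x ⊆ val y.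
Proof.
  split; intros h z hz; [|exact (h (val z) hz)].
  destruct (val_mem hz) as [z' <-]; exact (h z' hz).
Qed.

Lemma val_nonempty (x : N) : nonempty x <-> nonempty (val x).
Proof.
  split; intros [z hz]; [exists (val z); exact hz|].
  destruct (val_mem hz) as [z' <-]; exists z'; exact hz.
Qed.

Lemma val_pair (p x y : N) : is_pair p x y <-> is_pair (val p) (val x) (val y).
Proof.
  split; intros [s E]; (split; [exact s|]); intros z.
  - split; intros h.
    + destruct (val_mem h) as [z' <-]; destruct (proj1 (E z') h); subst; auto.
    + destruct h; subst; [exact (proj2 (E x) (or_introl eq_refl))
        |exact (proj2 (E y) (or_intror eq_refl))].
  - change (val z ∈ val p <-> z = x \/ z = y); rewrite E.
    split; intros [h|h]; subst; auto using val_inj.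
Qed.

Lemma val_opair (p x y : N) : is_opair p x y <-> is_opair (val p) (val x) (val y).
Proof.
  split.
  - intros (u & v & hu & hv & hp); exists (val u), (val v).
    rewrite <- !val_pair; auto.
  - intros (u & v & hu & hv & hp).
    destruct (@val_mem p u) as [u' <-]; [apply hp; auto|].
    destruct (@val_mem p v) as [v' <-]; [apply hp; auto|].
    exists u', v'; rewrite !val_pair; auto.
Qed.

Lemma opair_val (p : N) (x y : M) : is_opair (val p) x y ->
  (exists x' : N, val x' = x) /\ (exists y' : N, val y' = y).
Proof.
  intros (u & v & [_ hu] & [_ hv] & [_ hp]).
  destruct (@val_mem p v) as [v' <-]; [apply hp; auto|].
  split; apply (@val_mem v'), hv; auto.
Qed.

Lemma val_app (f x y : N) : app f x y <-> app (val f) (val x) (val y).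
Proof.
  split; intros (p & o & hp).
  - exists (val p); split; [apply val_opair, o|exact hp].
  - destruct (val_mem hp) as [p' <-]; exists p'; split; [apply val_opair, o|exact hp].
Qed.

Lemma app_val (f : N) (x y : M) : app (val f) x y ->
  (exists x' : N, val x' = x) /\ (exists y' : N, val y' = y).
Proof.
  intros (p & o & hp); destruct (val_mem hp) as [p' <-]; eapply opair_val; eauto.
Qed.

Lemma val_function_on (f x : N) : function_on f x <-> function_on (val f) (val x).
Proof.
  split; intros (s & hp & hu); (split; [exact s|split]).
  - intros p hpf; destruct (val_mem hpf) as [p' <-].
    destruct (hp p' hpf) as (u & v & hux & o); exists (val u), (val v).
    split; [exact hux|apply val_opair, o].
  - intros u hux; destruct (val_mem hux) as [u' <-].
    destruct (hu u' hux) as (v & hv & uniq); exists (val v); split; [apply val_app, hv|].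
    intros v1 hv1; destruct (app_val hv1) as [_ [v' <-]]; f_equal.
    apply uniq, val_app, hv1.
  - intros p hpf; destruct (hp (val p) hpf) as (u & v & hux & o).
    destruct (opair_val o) as [[u' <-] [v' <-]]; exists u', v'.
    split; [exact hux|apply val_opair, o].
  - intros u hux; destruct (hu (val u) hux) as (v & hv & uniq).
    destruct (app_val hv) as [_ [v' <-]]; exists v'; split; [apply val_app, hv|].
    intros v1 hv1; apply val_inj, uniq, val_app, hv1.
Qed.

Lemma val_function (f x y : N) : function f x y <-> function (val f) (val x) (val y).
Proof.
  unfold function; rewrite val_function_on; split; intros [ff h]; (split; [exact ff|]).
  - intros u v huv; destruct (app_val huv) as [[u' <-] [v' <-]].
    apply (h u' v'), val_app, huv.
  - intros u v huv; apply (h (val u) (val v)), val_app, huv.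
Qed.

Lemma val_injection (f x y : N) : injection f x y <-> injection (val f) (val x) (val y).
Proof.
  unfold injection; rewrite val_function; split; intros [ff h]; (split; [exact ff|]).
  - intros u u' v a a'; destruct (app_val a) as [[u0 <-] [v0 <-]].
    destruct (app_val a') as [[u1 <-] _]; f_equal; apply (h u0 u1 v0); apply val_app; auto.
  - intros u u' v a a'; apply val_inj, (h _ _ (val v)); apply val_app; auto.
Qed.

Lemma val_empty (x : N) : is_empty x <-> is_empty (val x).
Proof.
  split; intros [s h]; (split; [exact s|]); intros z hz; [|exact (h (val z) hz)].
  destruct (val_mem hz) as [z' <-]; exact (h z' hz).
Qed.

Lemma val_succ (y x : N) : is_succ y x <-> is_succ (val y) (val x).
Proof.
  split; intros [s E]; (split; [exact s|]); intros z.
  - split; intros h.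
    + destruct (val_mem h) as [z' <-]; destruct (proj1 (E z') h); subst; auto.
    + assert (hz : exists z' : N, val z' = z).
      { destruct h as [h| ->]; [exact (val_mem h)|eauto]. }
      destruct hz as [z' <-]; apply (proj2 (E z')).
      destruct h as [h|h]; [left; exact h|right; apply val_inj, h].
  - change (val z ∈ val y <-> val z ∈ val x \/ z = x); rewrite E.
    split; intros [h|h]; subst; auto using val_inj.
Qed.

Lemma val_inductive (x : N) : inductive_set x <-> inductive_set (val x).
Proof.
  split; intros (s & (o & ho & hox) & hS); (split; [exact s|split]).
  - exists (val o); split; [apply val_empty, ho|exact hox].
  - intros y hy; destruct (val_mem hy) as [y' <-]; destruct (hS y' hy) as (z & hz & hzx).
    exists (val z); split; [apply val_succ, hz|exact hzx].
  - destruct (val_mem hox) as [o' <-]; exists o'; split; [apply val_empty, ho|exact hox].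
  - intros y hy; destruct (hS (val y) hy) as (z & hz & hzx).
    destruct (val_mem hzx) as [z' <-]; exists z'; split; [apply val_succ, hz|exact hzx].
Qed.

(** Inside the model fewer inductive sets are tested, but [w] is one of them, so the intersection is
    the same. *)
Lemma val_omega (w' : N) : is_omega w' <-> val w' = w.
Proof.
  destruct (val_surj HS_omega) as [wN hwN].
  assert (iw : inductive_set wN).
  { apply val_inductive; rewrite hwN; apply (omega_inductive hw). }
  assert (K : forall n : N, val n ∈ w <-> forall x : N, inductive_set x -> n ∈ x).
  { intros n; split.
    - intros hn x hx; apply val_inductive in hx; destruct (hw) as [_ E].
      exact (proj1 (E _) hn _ hx).
    - intros h; rewrite <- hwN; exact (h wN iw). }
  split.
  - intros [s E]; apply extensionality; [exact s|apply hw|]; intros z; split; intros hz.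
    + destruct (val_mem hz) as [z' <-]; apply K, E, hz.
    + destruct (val_surj (HS_nat hz)) as [z' <-]; apply (proj2 (E z')), K, hz.
  - intros h; split; [change (isset (val w')); rewrite h; apply hw|].
    intros n; rewrite <- K, <- h; reflexivity.
Qed.

(** Countability is not absolute: the injection must itself lie in the model, as [HS_countable]
    demands. *)
Lemma val_countable (x : N) : countable x <-> HS_countable (val x).
Proof.
  split.
  - intros (s & w' & f & hw' & hf); split; [exact s|]; exists (val f).
    apply val_omega in hw'; rewrite <- hw'.
    split; [apply val_HS|apply val_injection, hf].
  - intros (s & f & sf & hf); split; [exact s|].
    destruct (val_surj HS_omega) as [w' hw'], (val_surj sf) as [f' <-].
    exists w', f'; split; [apply val_omega, hw'|].
    apply val_injection; rewrite hw'; exact hf.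
Qed.

Lemma val_choice (x : N) : has_choice_function x <-> HS_choice (val x).
Proof.
  split.
  - intros (f & ff & h); exists (val f); split; [apply val_HS|].
    split; [apply val_function_on, ff|]; intros u v huv.
    destruct (app_val huv) as [[u' <-] [v' <-]]; apply (h u' v'), val_app, huv.
  - intros (f & sf & ff & h); destruct (val_surj sf) as [f' <-]; exists f'.
    split; [apply val_function_on, ff|]; intros u v huv.
    exact (h _ _ (proj1 (val_app _ _ _) huv)).
Qed.

Lemma val_CAC (Y : N) : CAC Y <-> HS_CAC (val Y).
Proof.
  split; intros h K.
  - intros sK cK hK; destruct (val_surj sK) as [K' <-]; apply val_choice, h.
    + apply val_countable, cK.
    + intros k hk; destruct (hK (val k) hk) as (s & n & i).
      rewrite val_nonempty, val_subset; auto.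
  - intros cK hK; apply val_choice, h; [apply val_HS|apply val_countable, cK|].
    intros k hk; destruct (val_mem hk) as [k' <-].
    destruct (hK k' hk) as (s & n & i); rewrite val_nonempty, val_subset in *; auto.
Qed.

Lemma val_in_C (X An x : N) : in_C X An x <-> HS_in_C (val X) (val An) (val x).
Proof.
  unfold in_C, HS_in_C; rewrite val_countable, val_subset; split.
  - intros (c & s & h); split; [apply val_HS|split; [exact c|split; [exact s|]]].
    intros z hz; destruct (val_mem hz) as [z' <-]; destruct (h z' hz) as (t & ht & htz).
    exists (val t); auto.
  - intros (_ & c & s & h); split; [exact c|split; [exact s|]]; intros z hz.
    destruct (h (val z) hz) as (t & ht & htz); destruct (val_mem ht) as [t' <-].
    exists t'; auto.
Qed.

(** * The two conclusions inside the permutation model *)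

Lemma perm_model_CAC_omega_power : CAC_omega_power N.
Proof.
  intros X _ cX; destruct (val_surj HS_omega) as [w' hw'].
  destruct (product_ex w (val X)) as (Z & _ & EZ), (power_ex Z) as (PZ & _ & EPZ).
  destruct (@separation (fun f => HS f /\ function f w (val X)) ltac:(definability) PZ)
    as (P & sP & EP0).
  assert (EP : forall f, f ∈ P <-> HS f /\ function f w (val X)).
  { intros f; rewrite EP0; split; [tauto|]; intros h; split; [|exact h].
    destruct h as (_ & ff & fX); apply EPZ; split; [apply ff|]; intros p hp.
    destruct (ff) as (_ & h & _); destruct (h p hp) as (u & v & hu & o).
    apply EZ; exists u, v; split; [exact hu|split; [|exact o]].
    apply (fX u v); exists p; auto. }
  assert (hP : HS P).
  (* A support of [X] permutes the hereditarily symmetric functions from [w] to [X], hence supports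
     their set [P]. *)
  { destruct (HS_support (val_HS X)) as (b & hbB & fX).
    pose proof (base_perm_group hbB) as hH.
    apply (HS_intro hbB); [|intros f h; apply EP in h; apply h].
    apply (fixes_closed hH sP); intros phi f hp hf; apply EP in hf; destruct hf as [sf hf].
    destruct (acts_total hH hp (HS_in_transitive sf)) as [f' hf'].
    exists f'; split; [|exact hf']; apply EP.
    split; [exact (HS_acts (base_sub hbB hp) sf hf')|].
    exact (acts_function hH hp hf' (fixes_omega hH hw hp) (fX phi hp) hf). }
  destruct (val_surj hP) as [P' <-]; exists w', P'.
  split; [apply val_omega, hw'|split].
  - split; [exact sP|]; intros f; rewrite val_function, hw'.
    change (val f ∈ val P' <-> function (val f) w (val X)); rewrite EP.
    pose proof (val_HS f); tauto.
  - apply val_CAC, (HS_CAC_omega_power (val_HS X)); [apply val_CAC, cX|exact EP].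
Qed.

Lemma perm_model_PS0_II : PS0_II N.
Proof.
  destruct (val_surj HS_omega) as [w' hw']; exists w'; split; [apply val_omega, hw'|].
  intros X a _ _ fa _ _ hne; apply val_function_on in fa; rewrite hw' in fa.
  destruct (HS_PS0_II (val_HS X) (val_HS a) fa) as (K & hK & sK & EK & cK).
  { intros n An h; destruct (app_val h) as [[n' <-] [An' <-]].
    destruct (hne n' An') as [x hx].
    - change (val n' ∈ val w'); rewrite hw'; exact (function_on_dom fa h).
    - apply val_app, h.
    - exists (val x); apply val_in_C, hx. }
  destruct (val_surj hK) as [K' <-]; exists K'; split; [exact sK|split].
  - intros C; change (val C ∈ val K' <-> isset C /\ exists n An : N, val n ∈ val w' /\
      app a n An /\ forall x : N, val x ∈ val C <-> in_C X An x).
    rewrite EK, hw'; split; intros (s & n & An & hn & h & E); (split; [exact s|]).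
    + destruct (app_val h) as [[n' <-] [An' <-]]; exists n', An'.
      split; [exact hn|split; [apply val_app, h|]].
      intros x; rewrite E, val_in_C; reflexivity.
    + exists (val n), (val An); split; [exact hn|split; [apply val_app, h|]].
      intros x; split; intros hx.
      * destruct (val_mem hx) as [x' <-]; apply val_in_C, E, hx.
      * destruct (hx) as [sx _]; destruct (val_surj sx) as [x' <-].
        apply E, val_in_C, hx.
  - apply val_choice, cK.
Qed.

End OmegaSymmetric.
End Symmetric.
End Atoms.
End SetTheory.

Theorem theorem8p17 (M : structure) (A G F B : M)
  (hZFA : models_ZFA M) (hAC : models_AC M)
  (hA : is_atom_set A)
  (hG : perm_group A G)
  (hF : normal_filter A G F)
  (hB : filter_base A G B)
  (hgen : generated_by A G B F)
  (ha : forall x b phi y : M,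
      hereditarily_symmetric G F x -> b ∈ B -> phi ∈ G ->
      acts phi x y -> fixes b x -> fixes b y)
  (hb : forall x : M, hereditarily_symmetric G F x ->
      exists O : perm_model G F,
        is_orbit G x (proj1_sig O) /\ countable O) :
  CAC_omega_power (perm_model G F) /\ PS0_II (perm_model G F).
Proof.
  destruct (omega_ex hZFA) as [w hw]; split.
  - exact (perm_model_CAC_omega_power hZFA hA hG hB hgen hw hAC ha).
  - apply (perm_model_PS0_II hZFA hA hG hB hgen hw hAC ha).
    intros x hx; destruct (hb x hx) as (O & hO & cO); exists (proj1_sig O).
    (* Condition (b) states countability inside the model; it is translated to the form used in
       [M]. *)
    split; [exact hO|]; apply (val_countable hZFA hA hG hB hgen hw), cO.
Qed.
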